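(* Let $\mathcal P=\{\mathbb P=\mathbb P_X\mathbb P_{Y\mid X}:\mathbb P_X\in\mathcal P_X,\ \mathbb P_{Y\mid X}\in\mathcal P_{Y\mid X}\}$, let $\mathbb P^*=\mathbb P^*_X\mathbb P^*_{Y\mid X}\in\mathcal P$, and let $\theta:\mathcal P\to\Theta\subseteq\mathbb R^p$ be a functional. Suppose the efficient influence function of $\theta(\cdot)$ at $\mathbb P^*$ relative to $\mathcal P$ is $\varphi^*_{\eta^*}(z)$, where $\eta:\mathcal P\to\Omega$ is a functional into a metric space $(\Omega,\rho)$ and $\eta^*=\eta(\mathbb P^* )$. Put $\phi^*_{\eta^*}(x)=\mathbb E[\varphi^*_{\eta^*}(Z)\mid X=x]$. Then the efficient influence function of $\theta(\cdot)$ at $\mathbb P^*$ relative to the reduced model $$\{\mathbb P^*_X\}\otimes\mathcal P_{Y\mid X}=\{\mathbb P=\mathbb P^*_X\mathbb P_{Y\mid X}:\mathbb P_{Y\mid X}\in\mathcal P_{Y\mid X}\}$$ is $$\varphi^*_{\eta^*}(z)-\phi^*_{\eta^*}(x),\qquad z=(x,y).$$ Furthermore, the semiparametric efficiency lower bound relative to the reduced model satisfies $$\mathrm{Var}[\varphi^*_{\eta^*}(Z)-\phi^*_{\eta^*}(X)]=\mathrm{Var}[\varphi^*_{\eta^*}(Z)]-\mathrm{Var}[\phi^*_{\eta^*}(X)]\preceq\mathrm{Var}[\varphi^*_{\eta^*}(Z)].$$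
   Context: $Z=(X,Y)$ takes values in $\mathcal Z=\mathcal X\times\mathcal Y$ with $Z\sim\mathbb P^*=\mathbb P^*_X\mathbb P^*_{Y\mid X}$ (marginal of $X$ times conditional of $Y$ given $X$). All models are dominated by a common measure. $\mathcal P_X$ is a set of marginal distributions containing $\mathbb P_X^*$ and $\mathcal P_{Y\mid X}$ a set of conditional distributions containing $\mathbb P^*_{Y\mid X}$. $\mathcal L^2_{p,0}(\mathbb P)$ is the space of $\mathbb R^p$-valued functions with mean zero and $\mathbb E\|f\|^2<\infty$ under $\mathbb P$. $A\preceq B$ means $B-A$ is positive semidefinite; $\mathrm{Var}$ is the covariance matrix; expectations are under $\mathbb P^*$. Efficiency notions, for a model $\mathcal M$ (a set of distributions of $Z$) containing $\mathbb P^*$: a one-dimensional regular parametric sub-model is a family $\{\mathbb P_t:t\in T\subset\mathbb R\}\subset\mathcal M$ with $\mathbb P_{t^*}=\mathbb P^*$ for some $t^*\in T$ and density differentiable in quadratic mean at $t^*$, with score function $s_{t^*}\in\mathcal L^2_{1,0}(\mathbb P^* )$. The tangent space $\mathcal T_{\mathcal M}(\mathbb P^* )$ is the closed linear span in $\mathcal L^2_{1,0}(\mathbb P^* )$ of all such scores. $D\in\mathcal L^2_{p,0}(\mathbb P^* )$ is a gradient of $\theta(\cdot)$ at $\mathbb P^*$ relative to $\mathcal M$ if $\frac{d}{dt}\theta(\mathbb P_t)|_{t=t^*}=\mathbb E[D(Z)s_{t^*}(Z)]$ for every such sub-model ($\theta$ is then pathwise differentiable). A gradient $D$ is the efficient influence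 function (canonical gradient) if $a^\top D\in\mathcal T_{\mathcal M}(\mathbb P^* )$ for all $a\in\mathbb R^p$. The semiparametric efficiency lower bound relative to $\mathcal M$ is the variance matrix of the efficient influence function relative to $\mathcal M$. The subscript $\eta^*$ only records that the function depends on $\mathbb P^*$ through $\eta^*$. *)

(* Defs.v *)
From HB Require Import structures.
From mathcomp Require Import all_boot all_order all_algebra.
From mathcomp Require Import all_classical all_reals all_analysis.
From mathcomp Require Import measurable_realfun.

Set Implicit Arguments.
Unset Strict Implicit.
Unset Printing Implicit Defensive.

Import Order.TTheory GRing.Theory Num.Theory.
Import numFieldNormedType.Exports.

Local Open Scope classical_set_scope.
Local Open Scope ring_scope.

(* The law P_X P_{Y|X} of a pair (X, Y): a marginal and a conditional law.    *)
Section joint_law.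
Context dX dY (X : measurableType dX) (Y : measurableType dY) (R : realType).
Variables (PX : probability X R) (K : R.-pker X ~> Y).
Local Open Scope ereal_scope.

Definition joint (A : set (X * Y)) : \bar R :=
  \int[PX]_x K x (xsection A x).

Let joint0 : joint set0 = 0.
Proof. by apply: integral0_eq => x _; rewrite xsection0 measure0. Qed.

Let joint_ge0 A : 0 <= joint A.
Proof. by apply: integral_ge0 => x _; exact: measure_ge0. Qed.

Let joint_sigma_additive : semi_sigma_additive joint.
Proof.
move=> F mF tF mUF.
have mk n : measurable_fun setT (fun x => K x (xsection (F n) x)).
  by apply: measurable_fun_xsection_finite_kernel; rewrite inE.
have -> : joint (\bigcup_n F n) =
    \int[PX]_x \sum_(0 <= n <oo) K x (xsection (F n) x).
  apply: eq_integral => x _; rewrite xsection_bigcup.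
  apply/esym/cvg_lim => //; apply: measure_semi_sigma_additive => //.
  - by move=> n; exact: measurable_xsection.
  - exact: trivIset_xsection.
  - by apply: bigcup_measurable => n _; exact: measurable_xsection.
rewrite integral_nneseries//.
by apply: is_cvg_nneseries => n _ _; exact: joint_ge0.
Qed.

HB.instance Definition _ :=
  isMeasure.Build _ _ _ joint joint0 joint_ge0 joint_sigma_additive.

Let joint_setT : joint setT = 1.
Proof.
transitivity (\int[PX]_x (cst 1 x)).
  by apply: eq_integral => x _; rewrite xsectionE preimage_setT prob_kernel.
by rewrite integral_cst// mul1e; exact: probability_setT.
Qed.

HB.instance Definition _ := Measure_isProbability.Build _ _ _ joint joint_setT.

End joint_law.

Section models.
Context dX dY (X : measurableType dX) (Y : measurableType dY) (R : realType).

Definition product_model (MX : set (probability X R))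
    (MYX : set (R.-pker X ~> Y)) : set (probability (X * Y)%type R) :=
  [set P | exists PX K, [/\ MX PX, MYX K & P = joint PX K]].

(* g is a version of x |-> E_P[f(X, Y) | X = x]. *)
Definition cond_expectation (P : probability (X * Y)%type R)
    (f : X * Y -> R) (g : X -> R) : Prop :=
  [/\ measurable_fun setT g,
      P.-integrable setT (EFin \o (g \o fst)) &
      forall A, measurable A ->
        (\int[P]_(z in A `*` setT) (g z.1)%:E =
         \int[P]_(z in A `*` setT) (f z)%:E)%E].

End models.

Section efficiency.
Context d (Z : measurableType d) (R : realType).
Implicit Types (P : probability Z R) (s h : Z -> R) (M : set (probability Z R)).

Definition L20 P s : Prop := s \in Lfun P 2%:E /\ ('E_P[s] = 0)%E.

Definition vL20 (p : nat) P (f : Z -> 'cV[R]_p) : Prop :=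
  [/\ forall i, measurable_fun setT (fun z => f z i 0),
      ('E_P[fun z => (\sum_i f z i 0 ^+ 2)%R] < +oo)%E &
      forall i, ('E_P[fun z => f z i 0%R] = 0)%E].

Definition covmx (p : nat) P (f : Z -> 'cV[R]_p) : 'M[R]_p :=
  \matrix_(i, j) fine (covariance P (fun z => f z i 0) (fun z => f z j 0)).

Variable mu : {sigma_finite_measure set Z -> \bar R}.

(* The Radon-Nikodym derivative is finite when P `<< mu; both it and the     *)
(* notions below depend on its version only up to mu-null sets.              *)
Definition density P (z : Z) : R :=
  fine (Radon_Nikodym (charge_of_finite_measure P) mu z).

(* The parameter set T is an arbitrary subset of R, so limits are taken for  *)
(* t -> t0 with t in T and t != t0; t0 has to be a limit point of T, since   *)
(* otherwise such limits would be vacuous and every s would be a score.      *)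
Definition dqm (T : set R) (t0 : R) (Pt : R -> probability Z R) s : Prop :=
  (fun t => (((t - t0) ^- 2)%:E *
     \int[mu]_z ((Num.sqrt (density (Pt t) z) - Num.sqrt (density (Pt t0) z)
       - (t - t0) / 2 * s z * Num.sqrt (density (Pt t0) z)) ^+ 2)%:E)%E)
    @ within T t0^' --> 0%E.

Definition regular_submodel M P0 (T : set R) (t0 : R)
    (Pt : R -> probability Z R) s : Prop :=
  [/\ T t0 /\ limit_point T t0,
      forall t, T t -> M (Pt t),
      Pt t0 = P0,
      L20 P0 s &
      dqm T t0 Pt s].

Definition is_score M P0 s : Prop :=
  exists T t0 Pt, regular_submodel M P0 T t0 Pt s.

(* Closure in L2(P0) of the linear span of the scores. *)
Definition tangent_space M P0 h : Prop :=
  L20 P0 h /\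
  forall e : R, 0 < e ->
    exists (n : nat) (c : 'I_n -> R) (s : 'I_n -> Z -> R),
      (forall i, is_score M P0 (s i)) /\
      ('N[P0]_2%:E[EFin \o (fun z => h z - \sum_i c i * s i z)%R] < e%:E)%E.

Section functional.
Variables (p : nat) (M : set (probability Z R)) (P0 : probability Z R).
Variable theta : probability Z R -> 'cV[R]_p.

Definition gradient (D : Z -> 'cV[R]_p) : Prop :=
  vL20 P0 D /\
  forall T t0 Pt s, regular_submodel M P0 T t0 Pt s ->
    (fun t => (t - t0)^-1 *: (theta (Pt t) - theta (Pt t0)))
      @ within T t0^'
      --> (\col_i fine 'E_P0[fun z => (D z i 0 * s z)%R]%E).

Definition efficient_influence_function (D : Z -> 'cV[R]_p) : Prop :=
  gradient D /\
  forall a : 'cV[R]_p, tangent_space M P0 (fun z => (a^T *m D z) 0 0).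

Definition efficiency_bound (V : 'M[R]_p) : Prop :=
  exists2 D, efficient_influence_function D & V = covmx P0 D.

End functional.
End efficiency.

Definition psdmx (R : realType) (p : nat) (A : 'M[R]_p) : Prop :=
  A^T = A /\ forall a : 'cV[R]_p, 0 <= (a^T *m A *m a) 0 0.

Definition loewner_le (R : realType) (p : nat) (A B : 'M[R]_p) : Prop :=
  psdmx (B - A).

(* Main.v *)
(** Let P_t = P_{X,t} P_{Y|X,t} be a regular path in the full model with score
    s, and let s_X(x) = E[s | X = x]. The path P*_X P_{Y|X,t} lies in the
    reduced model, and it is again differentiable in quadratic mean, with score
    s - s_X. To see this, write the root densities as a(x) b(z), where a^2 is
    the density of the marginal with respect to P_{X,t} + P*_X and b^2 that of
    the joint law of this sum and the kernel. Since b_t^2 and b_0^2 have the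
    same X-marginal, the remainder of the marginal expansion can be estimated
    by the remainder of the joint expansion plus truncation tails of s, and so
    can the remainder for a_0 b_t. Taking linear combinations and L2 limits,
    the projection f -> f - E[f | X] maps the tangent space of the full model
    into that of the reduced model. Conversely, every score of the reduced
    model is orthogonal to the functions of X (expand the constant integral of
    k(x) along the path), so subtracting phi from varphi leaves all pathwise
    derivatives in the reduced model unchanged. The variance identity is
    Pythagoras for the conditional expectation. *)

Require Import Defs.
From HB Require Import structures.
From mathcomp Require Import all_boot all_order all_algebra.
From mathcomp Require Import all_classical all_reals all_analysis.
From mathcomp Require Import measurable_realfun ring lra.
Import Order.TTheory GRing.Theory Num.Theory.
Import numFieldNormedType.Exports.
Local Open Scope classical_set_scope.
Local Open Scope ring_scope.

Set Implicit Arguments.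
Unset Strict Implicit.
Unset Printing Implicit Defensive.

(** * Square-integrable functions *)

(** The measure [mu] lives on the product space and need not be a product measure, so it supplies
    neither a reference measure for marginals nor conditional densities. The sum of the two
    marginals at hand takes its place, which is why the factors [a] and [b] depend on the pair of
    laws compared. The factorization also involves the mixed laws, one marginal with the other
    kernel; these are dominated because the full model is a product. The obstacle is that a score is
    only square integrable. The kernel increment b - b0, weighted by a0, is of order h in L2, but
    its product with s need not be small in any useful sense. Clipping s at a level N bounds the
    error by h times (N times O(h), plus the L2 norms of the tails of s and s_X), up to a multiple
    of the given joint remainder. This is o(h) because N is fixed before t tends to t0. The same
    truncation extends orthogonality from bounded to square-integrable functions of X. *)

Section square_integrable.
Context d (T : measurableType d) (R : realType).
Variable mu : {measure set T -> \bar R}.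
Implicit Types (f g h : T -> R) (c : R).

Definition sqint f : Prop :=
  measurable_fun setT f /\ (\int[mu]_z (f z ^+ 2)%:E < +oo)%E.

(** Real-valued, so that inequalities can be closed by [lra]. An infinite integral is read as 0
    here, hence the [sqint] hypotheses of the bilinearity rules. *)
Definition ip f g : R := (\int[mu]_z (f z * g z))%R.

Definition nrm f : R := Num.sqrt (ip f f).

Lemma measurable_sqr_EFin f : measurable_fun setT f ->
  measurable_fun setT (fun z => (f z ^+ 2)%:E).
Proof. by move=> mf; apply/measurable_EFinP; exact: measurable_funX. Qed.

Lemma le_sqint f g : measurable_fun setT f -> (forall z, `|f z| <= `|g z|) ->
  sqint g -> sqint f.
Proof.
move=> mf fg [mg gi]; split=> //; apply: le_lt_trans gi.
apply: ge0_le_integral => //; try exact: measurable_sqr_EFin.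
- by move=> z _; rewrite lee_fin sqr_ge0.
- move=> z _; rewrite lee_fin -(real_normK (num_real (f z))).
  by rewrite -(real_normK (num_real (g z))) lerXn2r ?nnegrE.
Qed.

Lemma sqint_integrable f : sqint f -> mu.-integrable setT (EFin \o (fun z => f z ^+ 2)).
Proof.
move=> [mf fi]; apply/integrableP; split; first exact: measurable_sqr_EFin.
by under eq_integral do rewrite /= ger0_norm ?sqr_ge0//.
Qed.

Lemma sqintZ c f : sqint f -> sqint (fun z => c * f z).
Proof.
move=> sf; have [mf _] := sf; split; first exact: measurable_funM.
have := integrableZl measurableT (c ^+ 2) (sqint_integrable sf).
move=> /integrableP[_]; apply: le_lt_trans.
apply: ge0_le_integral => //.
- by move=> z _; rewrite lee_fin sqr_ge0.
- by apply: measurable_sqr_EFin; exact: measurable_funM.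
- apply/measurableT_comp => //; apply/measurable_EFinP.
  by apply: measurable_funM => //; exact: measurable_funX.
- by move=> z _ /=; rewrite lee_fin exprMn ler_norm.
Qed.

Lemma sqintD f g : sqint f -> sqint g -> sqint (fun z => f z + g z).
Proof.
move=> sf sg; have [mf _] := sf; have [mg _] := sg.
split; first exact: measurable_funD.
have h := integrableD measurableT (integrableZl measurableT 2 (sqint_integrable sf))
  (integrableZl measurableT 2 (sqint_integrable sg)).
have /integrableP[mh] := h; apply: le_lt_trans.
apply: ge0_le_integral => //.
- by move=> z _; rewrite lee_fin sqr_ge0.
- by apply: measurable_sqr_EFin; exact: measurable_funD.
- exact/measurableT_comp.
- move=> z _ /=; rewrite lee_fin; apply: le_trans (ler_norm _).
  by rewrite -subr_ge0; have := sqr_ge0 (f z - g z); nra.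
Qed.

Lemma sqintN f : sqint f -> sqint (fun z => - f z).
Proof. by move=> /(sqintZ (-1)); under eq_fun do rewrite mulN1r. Qed.

Lemma sqintB f g : sqint f -> sqint g -> sqint (fun z => f z - g z).
Proof. by move=> sf sg; apply: sqintD => //; exact: sqintN. Qed.

Lemma sqint0 : sqint (fun=> 0).
Proof.
by split=> //; rewrite integral0_eq// => z _; rewrite expr0n.
Qed.

Lemma sqint_norm f : sqint f -> sqint (fun z => `|f z|).
Proof.
move=> sf; apply: le_sqint (sf) => [|z]; last by rewrite normr_id.
by apply: measurableT_comp => //; case: sf.
Qed.

Lemma integrable_mul f g : sqint f -> sqint g ->
  mu.-integrable setT (EFin \o (fun z => f z * g z)).
Proof.
move=> sf sg; have [mf _] := sf; have [mg _] := sg.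
apply: le_integrable (integrableD measurableT (sqint_integrable sf)
  (sqint_integrable sg)) => //.
  by apply/measurable_EFinP; exact: measurable_funM.
move=> z _ /=; rewrite lee_fin [leRHS]ger0_norm; last by rewrite addr_ge0 ?sqr_ge0.
rewrite normrM -(real_normK (num_real (f z))) -(real_normK (num_real (g z))).
have := sqr_ge0 (`|f z| - `|g z|).
by have := normr_ge0 (f z); have := normr_ge0 (g z); nra.
Qed.

Lemma ipC f g : ip f g = ip g f.
Proof. by apply: eq_Rintegral => z _; rewrite mulrC. Qed.

Lemma ipDl f g h : sqint f -> sqint g -> sqint h ->
  ip (fun z => f z + g z) h = ip f h + ip g h.
Proof.
move=> sf sg sh; rewrite /ip -RintegralD ?integrable_mul//; try exact: integrable_mul.
by apply: eq_Rintegral => z _; rewrite mulrDl.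
Qed.

Lemma ipZl c f h : sqint f -> sqint h -> ip (fun z => c * f z) h = c * ip f h.
Proof.
move=> sf sh; rewrite /ip -RintegralZl ?integrable_mul//; try exact: integrable_mul.
by apply: eq_Rintegral => z _; rewrite mulrA.
Qed.

Lemma ipNl f h : sqint f -> sqint h -> ip (fun z => - f z) h = - ip f h.
Proof.
by move=> sf sh; rewrite -mulN1r -ipZl//; apply: eq_Rintegral => z _; rewrite mulN1r.
Qed.

Lemma ipBl f g h : sqint f -> sqint g -> sqint h ->
  ip (fun z => f z - g z) h = ip f h - ip g h.
Proof. by move=> sf sg sh; rewrite ipDl ?ipNl//; exact: sqintN. Qed.

Lemma ipDr f g h : sqint f -> sqint g -> sqint h ->
  ip h (fun z => f z + g z) = ip h f + ip h g.
Proof. by move=> sf sg sh; rewrite ipC ipDl// !(ipC h). Qed.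

Lemma ipZr c f h : sqint f -> sqint h -> ip h (fun z => c * f z) = c * ip h f.
Proof. by move=> sf sh; rewrite ipC ipZl// ipC. Qed.

Lemma ipBr f g h : sqint f -> sqint g -> sqint h ->
  ip h (fun z => f z - g z) = ip h f - ip h g.
Proof. by move=> sf sg sh; rewrite ipC ipBl// !(ipC h). Qed.

Lemma ip_ge0 f : 0 <= ip f f.
Proof. by apply: Rintegral_ge0 => z _; rewrite -expr2 sqr_ge0. Qed.

Lemma nrm_ge0 f : 0 <= nrm f. Proof. exact: sqrtr_ge0. Qed.

Lemma sqr_nrm f : nrm f ^+ 2 = ip f f.
Proof. by rewrite sqr_sqrtr ?ip_ge0. Qed.

Lemma integral_sqr f : sqint f -> (\int[mu]_z (f z ^+ 2)%:E)%E = (nrm f ^+ 2)%:E.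
Proof.
move=> sf; have [mf fi] := sf.
rewrite sqr_nrm /ip /Rintegral fineK//.
  rewrite ge0_fin_numE//; apply: integral_ge0 => z _.
  by rewrite lee_fin sqr_ge0.
Qed.

Lemma le_ip f1 g1 f2 g2 : sqint f1 -> sqint g1 -> sqint f2 -> sqint g2 ->
  (forall z, f1 z * g1 z <= f2 z * g2 z) -> ip f1 g1 <= ip f2 g2.
Proof. by move=> *; apply: le_Rintegral => //; exact: integrable_mul. Qed.

Lemma le_nrm f g : measurable_fun setT f -> sqint g ->
  (forall z, `|f z| <= `|g z|) -> nrm f <= nrm g.
Proof.
move=> mf sg fg; have sf := le_sqint mf fg sg.
rewrite ler_wsqrtr//; apply: le_ip => // z; rewrite -!expr2.
by rewrite -(real_normK (num_real (f z))) -(real_normK (num_real (g z))) lerXn2r ?nnegrE.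
Qed.

Lemma nrm_norm f : nrm (fun z => `|f z|) = nrm f.
Proof.
congr Num.sqrt; apply: eq_Rintegral => z _; rewrite -!expr2.
by rewrite real_normK ?num_real.
Qed.

Lemma nrmZ c f : sqint f -> nrm (fun z => c * f z) = `|c| * nrm f.
Proof.
move=> sf; rewrite /nrm ipZl ?ipZr//; last exact: sqintZ.
by rewrite mulrA -expr2 sqrtrM ?sqr_ge0// sqrtr_sqr.
Qed.

Lemma nrmN f : nrm (fun z => - f z) = nrm f.
Proof. by congr Num.sqrt; apply: eq_Rintegral => z _; rewrite mulrNN. Qed.

(** The quadratic polynomial t -> |f - t g|^2 is nonnegative. *)
Lemma cauchy_schwarz f g : sqint f -> sqint g -> `|ip f g| <= nrm f * nrm g.
Proof.
move=> sf sg; have H t : 0 <= ip f f - 2 * t * ip f g + t ^+ 2 * ip g g.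
  have := ip_ge0 (fun z => f z - t * g z).
  have st := sqintZ t sg; have sb := sqintB sf st.
  by rewrite ipBl// !ipBr// !ipZl// !ipZr// (ipC g f) => /le_trans; apply; lra.
rewrite -(ler_pXn2r (_ : (0 < 2)%N)) ?nnegrE ?mulr_ge0 ?nrm_ge0//.
rewrite exprMn !sqr_nrm real_normK ?num_real//.
have A0 := ip_ge0 f; have C0 := ip_ge0 g.
have [C|C] := eqVneq (ip g g) 0; last first.
  have Cp : 0 < ip g g by rewrite lt_def C C0.
  (* This [t] is the minimizer of the quadratic. *)
  have := H (ip f g / ip g g); rewrite -(pmulr_lge0 _ Cp).
  suff -> : (ip f f - 2 * (ip f g / ip g g) * ip f g + (ip f g / ip g g) ^+ 2 * ip g g)
    * ip g g = ip f f * ip g g - ip f g ^+ 2 by rewrite subr_ge0.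
  by field.
rewrite C mulr0; have [->|B] := eqVneq (ip f g) 0; first by rewrite expr0n.
(* The polynomial is now affine with nonzero slope; at this point its value is -1. *)
have := H ((ip f f + 1) / (2 * ip f g)); rewrite C mulr0 addr0.
have -> : 2 * ((ip f f + 1) / (2 * ip f g)) * ip f g = ip f f + 1 by field.
lra.
Qed.

Lemma nrmD f g : sqint f -> sqint g -> nrm (fun z => f z + g z) <= nrm f + nrm g.
Proof.
move=> sf sg; rewrite -(ler_pXn2r (_ : (0 < 2)%N)) ?nnegrE ?addr_ge0 ?nrm_ge0//.
have sD := sqintD sf sg.
rewrite sqr_nrm ipDl// !ipDr// (ipC g f) -!sqr_nrm.
by have /(le_trans (ler_norm _)) := cauchy_schwarz sf sg; nra.
Qed.

Lemma nrmB f g : sqint f -> sqint g -> nrm (fun z => f z - g z) <= nrm f + nrm g.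
Proof. by move=> sf /sqintN sg; rewrite -(nrmN g); exact: nrmD. Qed.

Lemma ip0 h : ip (fun=> 0) h = 0.
Proof.
by rewrite /ip; under eq_Rintegral do rewrite mul0r; rewrite Rintegral_cst// mul0r.
Qed.

Lemma sqint_sum n (c : 'I_n -> R) (s : 'I_n -> T -> R) : (forall i, sqint (s i)) ->
  sqint (fun z => \sum_i c i * s i z).
Proof.
elim: n c s => [|n IH] c s ss.
  by under eq_fun do rewrite big_ord0; exact: sqint0.
under eq_fun do rewrite big_ord_recl; apply: sqintD; first exact: sqintZ.
exact: IH.
Qed.

Lemma ip_suml n (c : 'I_n -> R) (s : 'I_n -> T -> R) h :
  (forall i, sqint (s i)) -> sqint h ->
  ip (fun z => \sum_i c i * s i z) h = \sum_i c i * ip (s i) h.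
Proof.
elim: n c s => [|n IH] c s ss sh.
  by under eq_fun do rewrite big_ord0; rewrite big_ord0 ip0.
under eq_fun do rewrite big_ord_recl; rewrite big_ord_recl ipDl//.
- by rewrite ipZl// IH.
- exact: sqintZ.
- exact: sqint_sum.
Qed.

Lemma le_ip_norm f1 g1 f2 g2 : sqint f1 -> sqint g1 -> sqint f2 -> sqint g2 ->
  (forall z, `|f1 z * g1 z| <= f2 z * g2 z) -> `|ip f1 g1| <= ip f2 g2.
Proof.
move=> s1 t1 s2 t2 H; apply: le_trans (le_normr_Rintegral _ (integrable_mul s1 t1)) _ => //.
apply: le_Rintegral => //; try exact: integrable_mul.
have := integrable_mul (sqint_norm s1) (sqint_norm t1).
by apply: eq_integrable => // z _ /=; rewrite normrM.
Qed.

End square_integrable.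

Section square_integrable_probability.
Context d (T : measurableType d) (R : realType) (P : probability T R).

Lemma sqint_cst (c : R) : sqint P (fun=> c).
Proof.
split=> //; rewrite integral_cst// [X in (_ * X)%E](_ : _ = 1%E);
  last exact: probability_setT.
by rewrite mule1 ltry.
Qed.

Lemma sqint_bounded (c : R) (f : T -> R) : measurable_fun setT f ->
  (forall z, `|f z| <= c) -> sqint P f.
Proof.
move=> mf fc; apply: le_sqint (sqint_cst c) => // z.
by apply: le_trans (fc z) (ler_norm c).
Qed.

Lemma sqint_integrable1 (f : T -> R) : sqint P f -> P.-integrable setT (EFin \o f).
Proof.
by move=> sf; have := integrable_mul sf (sqint_cst 1); under eq_fun do rewrite mulr1.
Qed.

End square_integrable_probability.
Arguments sqint {d T R} mu f.
Arguments ip {d T R} mu f g.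
Arguments nrm {d T R} mu f.

(** * Transport of integrals *)

Section transport.
Import HBNNSimple.
Local Open Scope ereal_scope.

Section one_side.
Context d d' (T : measurableType d) (X : measurableType d') (R : realType).
Variables (n : {measure set T -> \bar R}) (p : T -> X) (f : T -> R).
Hypotheses (mp : measurable_fun setT p) (mf : measurable_fun setT f)
  (f0 : forall z, (0 <= f z)%R).

Let mpre A : measurable A -> measurable (p @^-1` A).
Proof. by move=> mA; rewrite -[X in measurable X]setTI; exact: mp. Qed.

Let mind A : measurable A -> measurable_fun setT (fun z => (\1_A (p z) : R)).
Proof. by move=> mA; apply: measurableT_comp mp; exact: measurable_indic. Qed.

(** Splitting [h] into its level sets leaves only integrals of [f] over preimages under [p], the
    quantities that a transport hypothesis compares. *)
Lemma integral_nnsfun_comp (h : {nnsfun X >-> R}) :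
  \int[n]_z ((h (p z))%:E * (f z)%:E) =
  \sum_(y \in range h) (y%:E * \int[n]_(z in p @^-1` (h @^-1` [set y])) (f z)%:E).
Proof.
transitivity (\int[n]_z (\sum_(y \in range h)
    ((y * \1_(h @^-1` [set y]) (p z))%:E * (f z)%:E))).
  apply: eq_integral => z _; rewrite -ge0_mule_fsuml => [|y].
    by rewrite fsumEFin // -(fimfunE _ (p z)).
  exact: nnfun_muleindic_ge0.
rewrite ge0_integral_fsum//; last 2 first.
  - move=> y; apply: emeasurable_funM; apply/measurable_EFinP => //.
    by apply: measurable_funM => //; exact: mind.
  - by move=> y z _; apply: mule_ge0; [exact: nnfun_muleindic_ge0|rewrite lee_fin].
apply: eq_fsbigr => y /[!inE] -[x _ <-].
under eq_integral do rewrite EFinM -muleA.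
rewrite ge0_integralZl//.
- congr (_ * _); rewrite [RHS]integral_mkcond; apply: eq_integral => z _.
  rewrite patchE indicE.
  have -> : (p z \in h @^-1` [set h x]) = (z \in p @^-1` (h @^-1` [set h x])).
    by apply/idP/idP; rewrite !inE.
  by case: ifPn => _; rewrite ?mul1e ?mul0e.
- apply: emeasurable_funM; apply/measurable_EFinP => //.
  exact: mind.
- by move=> z _; rewrite mule_ge0 ?lee_fin.
- by rewrite lee_fin.
Qed.

Lemma integral_comp_lim (k : X -> \bar R) (mk : measurable_fun setT k) :
  (forall x, 0 <= k x) ->
  \int[n]_z (k (p z) * (f z)%:E) =
  limn (fun i => \int[n]_z ((nnsfun_approx measurableT mk i (p z))%:E * (f z)%:E)).
Proof.
move=> k0; rewrite -monotone_convergence//.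
- apply: eq_integral => z _; apply/esym/cvg_lim => //.
  by apply: cvgeZr => //; exact: cvg_nnsfun_approx.
- move=> i; apply: emeasurable_funM; apply/measurable_EFinP => //.
  exact: measurableT_comp.
- by move=> i z _; rewrite mule_ge0 ?lee_fin.
- by move=> z _ a b ab; rewrite lee_wpmul2r ?lee_fin//; exact/lefP/nd_nnsfun_approx.
Qed.

End one_side.

(* Two weighted measures with the same image under p1 and p2 give the same *)
(* integral to every nonnegative function of that image.                   *)
Lemma ge0_integral_transport d1 d2 d' (T1 : measurableType d1)
    (T2 : measurableType d2) (X : measurableType d') (R : realType)
    (n1 : {measure set T1 -> \bar R}) (n2 : {measure set T2 -> \bar R})
    (p1 : T1 -> X) (p2 : T2 -> X) (f1 : T1 -> R) (f2 : T2 -> R) :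
  measurable_fun setT p1 -> measurable_fun setT p2 ->
  measurable_fun setT f1 -> measurable_fun setT f2 ->
  (forall z, (0 <= f1 z)%R) -> (forall z, (0 <= f2 z)%R) ->
  (forall A, measurable A -> \int[n1]_(z in p1 @^-1` A) (f1 z)%:E =
                             \int[n2]_(z in p2 @^-1` A) (f2 z)%:E) ->
  forall k : X -> \bar R, measurable_fun setT k -> (forall x, 0 <= k x) ->
  \int[n1]_z (k (p1 z) * (f1 z)%:E) = \int[n2]_z (k (p2 z) * (f2 z)%:E).
Proof.
move=> mp1 mp2 mf1 mf2 f10 f20 H k mk k0.
rewrite (integral_comp_lim _ mp1 mf1 f10 mk)// (integral_comp_lim _ mp2 mf2 f20 mk)//.
congr (limn _); apply/funext => i; rewrite !integral_nnsfun_comp//.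
set h := nnsfun_approx _ _ _.
have mA y : measurable (h @^-1` [set y]) by exact: measurable_funPTI.
by apply: eq_fsbigr => y _; rewrite H.
Qed.

End transport.

(** * Root densities of joint laws *)

Lemma measurable_sqrtr d (T : measurableType d) (R : realType) (f : T -> R) :
  measurable_fun setT f -> measurable_fun setT (fun z => Num.sqrt (f z)).
Proof.
move=> mf; apply: measurableT_comp mf.
by apply: continuous_measurable_fun; exact: sqrt_continuous.
Qed.

Section sum_of_probabilities.
Context d (T : measurableType d) (R : realType) (P Q : probability T R).

(** A name of its own for [measure_add], to which a finite measure structure can be attached; [rden]
    needs a sigma-finite reference measure. *)
Definition sum_measure : set T -> \bar R := measure_add P Q.

HB.instance Definition _ := Measure.on sum_measure.

Let sum_measure_fin : fin_num_fun sum_measure.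
Proof.
by move=> A mA; rewrite /sum_measure measure_addE fin_numD !fin_num_measure.
Qed.

HB.instance Definition _ := Measure_isFinite.Build _ _ _ sum_measure sum_measure_fin.

Lemma integral_sum_measure (f : T -> \bar R) : measurable_fun setT f ->
  (forall x, 0 <= f x)%E ->
  (\int[sum_measure]_x f x = \int[P]_x f x + \int[Q]_x f x)%E.
Proof. by move=> mf f0; rewrite ge0_integral_measure_add. Qed.

Lemma dominates_suml : P `<< sum_measure.
Proof.
apply/null_content_dominatesP => A mA; rewrite /= /sum_measure measure_addE => /eqP.
by rewrite padde_eq0 ?measure_ge0// => /andP[/eqP].
Qed.

Lemma dominates_sumr : Q `<< sum_measure.
Proof.
apply/null_content_dominatesP => A mA; rewrite /= /sum_measure measure_addE => /eqP.
by rewrite padde_eq0 ?measure_ge0// => /andP[_ /eqP].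
Qed.

End sum_of_probabilities.

Section root_density.
Context d (Z : measurableType d) (R : realType).
Variables (mu : {sigma_finite_measure set Z -> \bar R}) (P : probability Z R).
Hypothesis Pmu : P `<< mu.

Definition rden (z : Z) : R := Num.sqrt (density mu P z).

Lemma rden_ge0 z : 0 <= rden z. Proof. exact: sqrtr_ge0. Qed.

Let RN := Radon_Nikodym (charge_of_finite_measure P) mu.

Let RNmu : charge_of_finite_measure P `<< mu. Proof. exact: Pmu. Qed.

Let iRN : mu.-integrable setT RN. Proof. exact: Radon_Nikodym_integrable. Qed.

Let mRN : measurable_fun setT RN. Proof. exact: measurable_int iRN. Qed.

Lemma measurable_rden : measurable_fun setT rden.
Proof. by apply: measurable_sqrtr; apply: measurableT_comp mRN. Qed.

Let RN_ge0 : {ae mu, forall z, (0 <= RN z)%E}.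
Proof.
have := ae_eq_Radon_Nikodym_SigmaFinite Pmu measurableT.
by apply: filterS => z /(_ I); rewrite /RN => <-; exact: Radon_Nikodym_SigmaFinite.f_ge0.
Qed.

(** [density] may be negative on a [mu]-null set, where [Num.sqrt] returns 0. The square of [rden]
    therefore recovers the density only almost everywhere, which suffices under the integral. *)
Lemma integral_rden A : measurable A -> (\int[mu]_(z in A) (rden z ^+ 2)%:E)%E = P A.
Proof.
move=> mA; transitivity (\int[mu]_(z in A) RN z)%E; last first.
  by rewrite -(Radon_Nikodym_integral RNmu).
apply: ae_eq_integral => //.
- apply: measurable_funTS; apply: measurable_sqr_EFin; exact: measurable_rden.
- exact: measurable_funTS.
- apply: filterS RN_ge0 => z h _; rewrite /rden sqr_sqrtr ?fine_ge0//.
  by rewrite fineK//; exact: Radon_Nikodym_fin_num.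
Qed.

Lemma rden_unique (f : Z -> R) : measurable_fun setT f -> (forall z, 0 <= f z) ->
  (forall A, measurable A -> (\int[mu]_(z in A) (f z ^+ 2)%:E)%E = P A) ->
  {ae mu, forall z, rden z = f z}.
Proof.
move=> mf f0 H.
have mr := measurable_rden.
have : ae_eq mu setT (fun z => (rden z ^+ 2)%:E) (fun z => (f z ^+ 2)%:E).
  apply: integral_ae_eq => //.
  - apply/integrableP; split; first exact: measurable_sqr_EFin.
    under eq_integral do rewrite gee0_abs ?lee_fin ?sqr_ge0//.
    by rewrite integral_rden// probability_setT ltry.
  - exact: measurable_sqr_EFin.
  - by move=> E _ mE; rewrite integral_rden// H.
apply: filterS => z /(_ I)[] /eqP.
by rewrite eqrXn2 ?rden_ge0// => /eqP.
Qed.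

Lemma sqint_rden : sqint mu rden.
Proof.
split; first exact: measurable_rden.
by rewrite integral_rden// probability_setT ltry.
Qed.

(** Transport along the identity: [mu] weighted by the density and [P] with weight 1 agree on
    measurable sets. *)
Lemma ge0_integral_rden (k : Z -> \bar R) : measurable_fun setT k ->
  (forall z, 0 <= k z)%E ->
  (\int[mu]_z (k z * (rden z ^+ 2)%:E) = \int[P]_z k z)%E.
Proof.
move=> mk k0.
rewrite (@ge0_integral_transport _ _ _ _ _ _ _ mu P id id _ (cst 1))//.
- by under eq_integral do rewrite mule1.
- by apply: measurable_funX; exact: measurable_rden.
- by move=> z; rewrite sqr_ge0.
- move=> A mA; rewrite integral_rden//.
  by rewrite (integral_cst _ _ 1%E)// mul1e.
Qed.

End root_density.

Section joint_integral.
Context dX dY (X : measurableType dX) (Y : measurableType dY) (R : realType).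
Local Open Scope ereal_scope.

(** The joint law weighted by the indicator of [B] and [PX] weighted by the kernel mass of the
    sections of [B] have the same image on [X], so transport gives this form of disintegration. *)
Lemma joint_ge0_integral (PX : probability X R) (K : R.-pker X ~> Y)
    (B : set (X * Y)) (k : X -> \bar R) :
  measurable B -> measurable_fun setT k -> (forall x, 0 <= k x) ->
  \int[joint PX K]_(z in B) k z.1 = \int[PX]_x (k x * K x (xsection B x)).
Proof.
move=> mB mk k0.
have mK : measurable_fun setT (fun x => K x (xsection B x)).
  by apply: measurable_fun_xsection_finite_kernel; rewrite inE.
have fK x : (fine (K x (xsection B x)))%:E = K x (xsection B x).
  rewrite fineK// ge0_fin_numE//; apply: (@le_lt_trans _ _ (K x setT)).
    by apply: le_measure; rewrite ?inE//; exact: measurable_xsection.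
  by rewrite prob_kernel ltry.
have := @ge0_integral_transport _ _ _ _ _ _ _ (joint PX K) PX fst id
  (\1_B) (fun x => fine (K x (xsection B x))).
move=> /(_ _ _ _ _ _ _ _ _ mk k0) => H.
rewrite integral_mkcond; under [RHS]eq_integral do rewrite -fK.
rewrite -H//.
- by apply: eq_integral => z _; rewrite epatch_indic.
- exact: measurableT_comp.
- move=> A mA.
  have mfA : measurable ((@fst X Y) @^-1` A).
    by rewrite -[X in measurable X]setTI; exact: measurable_fst.
  rewrite integral_indic//= [LHS]/joint [RHS]integral_mkcond.
  apply: eq_integral => x _; rewrite patchE fK; case: ifPn => xA.
    congr (K x _); apply/seteqP; split => y; rewrite /xsection /= !inE.
      by case.
    by move=> By; split => //; rewrite inE in xA.
  rewrite (_ : xsection _ x = set0) ?measure0//.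
  apply/seteqP; split => y //; rewrite /xsection /= inE => -[_ /=].
  by move=> Ax; move: xA; rewrite notin_setE.
Qed.

Lemma joint_fst (PX : probability X R) (K : R.-pker X ~> Y) (A : set X) :
  measurable A -> joint PX K (fst @^-1` A) = PX A.
Proof.
move=> mA; have mfA : measurable ((@fst X Y) @^-1` A).
  by rewrite -[X in measurable X]setTI; exact: measurable_fst.
transitivity (\int[PX]_x (\1_A x)%:E); last by rewrite integral_indic// setIT.
apply: eq_integral => x _; rewrite indicE; case: (boolP (x \in A)) => xA.
  rewrite (_ : xsection _ x = setT) ?prob_kernel//.
  by apply/seteqP; split => y //; rewrite /xsection /= inE /= => _; rewrite inE in xA.
rewrite (_ : xsection _ x = set0) ?measure0//.
by apply/seteqP; split => y //; rewrite /xsection /= inE /= => Ax; move: xA; rewrite notin_setE.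
Qed.

End joint_integral.

(** * Splitting root densities into a marginal and a conditional factor *)

Section factorization.
Context dX dY (X : measurableType dX) (Y : measurableType dY) (R : realType).
Variable mu : {sigma_finite_measure set (X * Y)%type -> \bar R}.
Implicit Types (PX QX : probability X R) (K : R.-pker X ~> Y).

(* Root density of the joint law of [PX + QX] and K. *)
Definition rden_sum PX QX K (z : X * Y) : R :=
  Num.sqrt (rden mu (joint PX K) z ^+ 2 + rden mu (joint QX K) z ^+ 2).

Lemma sqr_rden_sum PX QX K z : rden_sum PX QX K z ^+ 2 =
  rden mu (joint PX K) z ^+ 2 + rden mu (joint QX K) z ^+ 2.
Proof. by rewrite sqr_sqrtr// addr_ge0 ?sqr_ge0. Qed.

Lemma measurable_rden_sum PX QX K : joint PX K `<< mu -> joint QX K `<< mu ->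
  measurable_fun setT (rden_sum PX QX K).
Proof.
move=> Pm Qm; apply: measurable_sqrtr.
by apply: measurable_funD; apply: measurable_funX; exact: measurable_rden.
Qed.

Lemma ge0_integral_rden_sum PX QX K (k : X * Y -> \bar R) :
  joint PX K `<< mu -> joint QX K `<< mu ->
  measurable_fun setT k -> (forall z, 0 <= k z)%E ->
  (\int[mu]_z (k z * (rden_sum PX QX K z ^+ 2)%:E) =
   \int[joint PX K]_z k z + \int[joint QX K]_z k z)%E.
Proof.
move=> Pm Qm mk k0; have mP := measurable_rden Pm; have mQ := measurable_rden Qm.
under eq_integral do rewrite sqr_rden_sum EFinD ge0_muleDr ?lee_fin ?sqr_ge0//.
rewrite ge0_integralD//.
- by rewrite !ge0_integral_rden.
- by move=> z _; rewrite mule_ge0 ?lee_fin ?sqr_ge0.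
- by apply: emeasurable_funM => //; exact: measurable_sqr_EFin.
- by move=> z _; rewrite mule_ge0 ?lee_fin ?sqr_ge0.
- by apply: emeasurable_funM => //; exact: measurable_sqr_EFin.
Qed.

(** By uniqueness of densities it is enough to integrate the squared product over a set [B]. The
    squared second factor turns [mu] into the joint law of [PX + QX] and [K]; integrating out Y, the
    squared first factor then turns [PX + QX] into [RX]. *)
Lemma rden_factor PX QX RX K :
  joint PX K `<< mu -> joint QX K `<< mu -> joint RX K `<< mu ->
  RX `<< sum_measure PX QX ->
  {ae mu, forall z, rden mu (joint RX K) z =
     rden (sum_measure PX QX) RX z.1 * rden_sum PX QX K z}.
Proof.
move=> Pm Qm Rm Rs; set a := rden _ RX.
have ma : measurable_fun setT a by exact: measurable_rden.
have mb := measurable_rden_sum Pm Qm.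
apply: rden_unique => //.
- by apply: measurable_funM => //; exact: measurableT_comp.
- by move=> z; rewrite mulr_ge0 ?rden_ge0 ?sqrtr_ge0.
- move=> B mB.
  have mk : measurable_fun setT (fun z : X * Y => ((a z.1) ^+ 2)%:E).
    by apply/measurable_EFinP; apply: measurable_funX; exact: measurableT_comp.
  transitivity (\int[mu]_z (((fun z => (a z.1 ^+ 2)%:E) \_ B) z *
      (rden_sum PX QX K z ^+ 2)%:E))%E.
    rewrite integral_mkcond; apply: eq_integral => z _; rewrite !patchE.
    by case: ifPn => _; rewrite ?mul0e// exprMn EFinM.
  rewrite ge0_integral_rden_sum//; last 2 first.
  + by apply/(measurable_restrictT _ _).1 => //; exact: measurable_funTS.
  + by move=> z; rewrite patchE; case: ifPn => // _; rewrite lee_fin sqr_ge0.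
  rewrite -!integral_mkcond.
  have m2 : measurable_fun setT (fun x : X => ((a x) ^+ 2)%:E).
    by apply/measurable_EFinP; apply: measurable_funX.
  have mK : measurable_fun setT (fun x => K x (xsection B x)).
    by apply: measurable_fun_xsection_finite_kernel; rewrite inE.
  rewrite !(joint_ge0_integral _ _ mB m2)//; try by move=> x; rewrite lee_fin sqr_ge0.
  rewrite -integral_sum_measure//; last 2 first.
  + exact: emeasurable_funM.
  + by move=> x; rewrite mule_ge0 ?lee_fin ?sqr_ge0.
  under eq_integral do rewrite muleC.
  by rewrite (ge0_integral_rden Rs).
Qed.

(** Whatever the kernel, the X-marginal of the law with root density [rden_sum] is [PX + QX]. This
    provides the hypothesis [same_marginal] below. *)
Lemma ge0_integral_fst_rden_sum PX QX K K' (k : X -> \bar R) :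
  joint PX K `<< mu -> joint QX K `<< mu ->
  joint PX K' `<< mu -> joint QX K' `<< mu ->
  measurable_fun setT k -> (forall x, 0 <= k x)%E ->
  (\int[mu]_z (k z.1 * (rden_sum PX QX K z ^+ 2)%:E) =
   \int[mu]_z (k z.1 * (rden_sum PX QX K' z ^+ 2)%:E))%E.
Proof.
move=> Pm Qm Pm' Qm' mk k0.
have mk1 : measurable_fun setT (fun z : X * Y => k z.1) by exact: measurableT_comp.
rewrite !ge0_integral_rden_sum// !(joint_ge0_integral _ _ measurableT)//.
have KT (L : R.-pker X ~> Y) x : L x (xsection setT x) = 1%E.
  by rewrite xsectionE preimage_setT prob_kernel.
by congr (_ + _)%E; apply: eq_integral => x _; rewrite !KT.
Qed.

End factorization.

(** * The conditional expansion *)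

Section clip.
Context (R : realType).
Implicit Types (M N x : R).

Definition clip N x : R := Num.max (- N) (Num.min N x).

Definition tail N x : R := x - clip N x.

Lemma clip_le N x : 0 <= N -> `|clip N x| <= N.
Proof.
move=> N0; rewrite /clip ler_norml le_max lexx/= ge_max ge_min lexx/= andbT.
by move: N0; lra.
Qed.

Lemma clip_id N x : `|x| <= N -> clip N x = x.
Proof. by rewrite ler_norml /clip => /andP[h1 h2]; rewrite min_r// max_r. Qed.

Lemma clip_tail N x : clip N x + tail N x = x.
Proof. by rewrite /tail addrC subrK. Qed.

Lemma tail_le N x : 0 <= N -> `|tail N x| <= `|x|.
Proof.
move=> N0; rewrite /tail /clip.
case: (leP x (- N)) => [h1|h1]; last case: (leP N x) => [h2|h2].
- rewrite min_r ?max_l//; last by apply: le_trans h1 _; lra.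
  by rewrite opprK !ler0_norm; lra.
- rewrite max_r; last by lra.
  by rewrite !ger0_norm; lra.
- by rewrite max_r ?subrr ?normr0// ltW.
Qed.

Lemma tail_eq0 N x : `|x| <= N -> tail N x = 0.
Proof. by move=> h; rewrite /tail clip_id// subrr. Qed.

Lemma measurable_clip d (T : measurableType d) N (f : T -> R) :
  measurable_fun setT f -> measurable_fun setT (fun z => clip N (f z)).
Proof.
move=> mf; apply: measurable_maxr => //.
by apply: measurable_minr.
Qed.

Lemma measurable_tail d (T : measurableType d) N (f : T -> R) :
  measurable_fun setT f -> measurable_fun setT (fun z => tail N (f z)).
Proof. by move=> mf; apply: measurable_funB => //; exact: measurable_clip. Qed.

Lemma normr_clip N x : 0 <= N -> `|clip N x| = Num.min N `|x|.
Proof.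
move=> N0; case: (leP `|x| N) => h; first by rewrite clip_id.
rewrite /clip; case: (leP 0 x) => x0.
  by rewrite ger0_norm// in h; rewrite min_l ?ltW// max_r ?ger0_norm//; lra.
rewrite ltr0_norm// in h; rewrite min_r; last by lra.
by rewrite max_l ?normrN ?ger0_norm//; lra.
Qed.

Lemma sqr_clip_le M N x : 0 <= M -> M <= N -> clip M x ^+ 2 <= clip N x ^+ 2.
Proof.
move=> M0 MN; have N0 := le_trans M0 MN.
rewrite -(real_normK (num_real (clip M x))) -(real_normK (num_real (clip N x))).
rewrite lerXn2r ?nnegrE// !normr_clip//.
by rewrite le_min !ge_min MN lexx orbT.
Qed.

(** Clipping keeps the sign and does not increase the absolute value. *)
Lemma sqr_clip_le_mul N x : 0 <= N -> clip N x ^+ 2 <= x * clip N x.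
Proof.
move=> N0; case: (leP `|x| N) => h; first by rewrite clip_id// expr2.
rewrite /clip; case: (leP 0 x) => x0.
  rewrite ger0_norm// in h; rewrite min_l ?(ltW h)// max_r; last by lra.
  by rewrite expr2 ler_wpM2r// (ltW h).
rewrite ltr0_norm// in h; rewrite min_r; last by lra.
rewrite max_l; last by lra.
by rewrite sqrrN expr2 mulrN -mulNr ler_wpM2r//; lra.
Qed.

Lemma clip_cvg x : clip n%:R x @[n --> \oo] --> x.
Proof.
apply: cvg_near_cst; near=> n; rewrite clip_id//.
near: n; exact: nbhs_infty_ger.
Unshelve. all: by end_near. Qed.

End clip.

(* mu is the dominating measure and pi the projection on X. The functions b^2  *)
(* and b0^2 are densities of two joint laws with the same X-marginal, whereas  *)
(* a0 # b0, a # b and a0 # b are the root densities of the law at t0, of the   *)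
(* law at t, and of the law at t with its marginal replaced by the one at t0;  *)
(* h' is half the increment of the parameter.                                  *)
Section conditional_error.
Context d d' (Z : measurableType d) (X : measurableType d') (R : realType).
Variables (mu : {measure set Z -> \bar R}) (pi : Z -> X) (b b0 : Z -> R).
Hypotheses (mpi : measurable_fun setT pi)
  (mb : measurable_fun setT b) (mb0 : measurable_fun setT b0).
Hypothesis same_marginal : forall k : X -> \bar R, measurable_fun setT k ->
  (forall x, 0 <= k x)%E ->
  (\int[mu]_z (k (pi z) * (b z ^+ 2)%:E) = \int[mu]_z (k (pi z) * (b0 z ^+ 2)%:E))%E.

Local Notation "u # f" := (fun z => u (pi z) * f z) (at level 35).
Implicit Types (u v : X -> R) (f : Z -> R).
Local Notation ip := (ip mu).
Local Notation nrm := (nrm mu).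
Local Notation sqint := (sqint mu).
Local Notation mX u := (measurable_fun [set: X] u).

Lemma measurable_lift u f : mX u -> measurable_fun setT f ->
  measurable_fun setT (u # f).
Proof. by move=> mu' mf; apply: measurable_funM => //; exact: measurableT_comp. Qed.

Lemma integral_sqr_swap u : mX u ->
  (\int[mu]_z (((u # b) z) ^+ 2)%:E = \int[mu]_z (((u # b0) z) ^+ 2)%:E)%E.
Proof.
move=> mu'; under eq_integral do rewrite exprMn EFinM.
under [RHS]eq_integral do rewrite exprMn EFinM.
apply: (same_marginal (k := fun x => (u x ^+ 2)%:E)).
  exact: measurable_sqr_EFin.
by move=> x; rewrite lee_fin sqr_ge0.
Qed.

Lemma sqint_swap u : mX u -> sqint (u # b0) -> sqint (u # b).
Proof.
by move=> mu' [_ h]; split; [exact: measurable_lift|rewrite integral_sqr_swap].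
Qed.

Lemma ip_swap1 u : mX u -> ip (u # b) (u # b) = ip (u # b0) (u # b0).
Proof.
move=> mu'; congr fine.
by have := integral_sqr_swap mu'; under eq_integral do rewrite expr2;
  under [X in _ = X -> _]eq_integral do rewrite expr2.
Qed.

Lemma nrm_swap u : mX u -> nrm (u # b) = nrm (u # b0).
Proof. by move=> mu'; congr Num.sqrt; exact: ip_swap1. Qed.

(** Polarization of [ip_swap1], applied to [u], [v] and their sum. *)
Lemma ip_swap u v : mX u -> mX v -> sqint (u # b0) -> sqint (v # b0) ->
  ip (u # b) (v # b) = ip (u # b0) (v # b0).
Proof.
move=> mu' mv su sv; have su' := sqint_swap mu' su; have sv' := sqint_swap mv sv.
have mD : mX (fun x => u x + v x) by exact: measurable_funD.
have := ip_swap1 mD; have E f : ((fun x => u x + v x) # f) = (fun z => (u # f) z + (v # f) z).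
  by apply/funext => z; rewrite mulrDl.
rewrite !E !(ipDl, ipDr)//; try exact: sqintD.
rewrite !ip_swap1// !(ipC _ (v # _) (u # _)); lra.
Qed.

Variables (a a0 sX : X -> R) (s : Z -> R) (h' N : R).
Hypotheses (ma : mX a) (ma0 : mX a0) (msX : mX sX) (ms : measurable_fun setT s).
Hypotheses (a_ge0 : forall x, 0 <= a x) (a0_ge0 : forall x, 0 <= a0 x) (N_ge0 : 0 <= N).
Hypotheses (Iab0 : sqint (a # b0)) (Ia0b0 : sqint (a0 # b0)).

(* Remainders of the marginal (u) and of the joint (D) expansions. *)
Let u x := a x - a0 x - h' * (sX x * a0 x).
Let w z := b z - b0 z.
Let D z := (a # b) z - (a0 # b0) z - h' * (s z * (a0 # b0) z).

Hypotheses (Is : sqint (fun z => s z * (a0 # b0) z))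
  (IsX : sqint (fun z => sX (pi z) * (a0 # b0) z)).
Hypothesis sX_cond : forall k : X -> R, mX k -> sqint (k # b0) ->
  ip (k # b0) (fun z => s z * (a0 # b0) z) =
  ip (k # b0) (fun z => sX (pi z) * (a0 # b0) z).

Let Iab : sqint (a # b). Proof. exact: sqint_swap. Qed.
Let Ia0b : sqint (a0 # b). Proof. exact: sqint_swap. Qed.

Let Wsplit (f : X -> R) : (f # w) = (fun z => (f # b) z - (f # b0) z).
Proof. by apply/funext => z; rewrite /w mulrBr. Qed.

Let Iw (f : X -> R) : mX f -> sqint (f # b0) -> sqint (f # w).
Proof. by move=> mf sf; rewrite Wsplit; apply: sqintB => //; exact: sqint_swap. Qed.

Let nrm_w (f : X -> R) : mX f -> sqint (f # b0) -> nrm (f # w) <= 2 * nrm (f # b0).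
Proof.
move=> mf sf; rewrite Wsplit; apply: le_trans (nrmB _ _) _ => //.
  exact: sqint_swap.
by rewrite nrm_swap//; lra.
Qed.

Let ID : sqint D.
Proof. by apply: sqintB; [exact: sqintB|exact: sqintZ]. Qed.

Let E0 := fun z => (a # b) z - (a0 # b0) z.
Let IE0 : sqint E0. Proof. exact: sqintB. Qed.

(** Passing to marginals does not increase the Hellinger distance: the left side is the distance of
    the marginals, the right side that of the joint laws. *)
Lemma nrm_marginal_diff : nrm ((fun x => a x - a0 x) # b) <= nrm E0.
Proof.
have -> : (fun x => a x - a0 x) # b = (fun z => (a # b) z - (a0 # b) z).
  by apply/funext => z; rewrite mulrBl.
(* 2 <a b, a0 b0> <= <a b, a0 b> + <a b0, a0 b0>, as the gap is <a w, a0 w>. *)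
rewrite ler_wsqrtr// /E0.
rewrite !(ipBl, ipBr)//; try exact: sqintB.
have W : 0 <= ip (a # w) (a0 # w).
  by apply: Rintegral_ge0 => z _; have := a_ge0 (pi z); have := a0_ge0 (pi z);
    have := sqr_ge0 (w z); rewrite mulrACA -expr2 => *; rewrite mulr_ge0// mulr_ge0.
move: W; rewrite !Wsplit !(ipBl, ipBr)//; try exact: sqintB.
rewrite (ip_swap ma ma0)// (ip_swap1 ma0).
have -> : ip (a # b0) (a0 # b) = ip (a # b) (a0 # b0).
  by apply: eq_Rintegral => z _; ring.
rewrite (ipC _ (a0 # b) (a # b)) (ip_swap ma ma0)// (ipC _ (a0 # b0) (a # b)); lra.
Qed.

Lemma nrm_E0 : nrm E0 <= nrm D + `|h'| * nrm (fun z => s z * (a0 # b0) z).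
Proof.
have -> : E0 = (fun z => D z + h' * (s z * (a0 # b0) z)).
  by apply/funext => z; rewrite /D /E0; ring.
by apply: le_trans (nrmD _ _) _ => //; [exact: sqintZ|rewrite nrmZ].
Qed.

(** The kernel increment under the fixed marginal is the joint increment minus the marginal one, and
    each has norm at most that of [E0]. Hence it is of the order of [h'] once [nrm D] is. *)
Lemma nrm_a0w : nrm (a0 # w) <=
  2 * (nrm D + `|h'| * nrm (fun z => s z * (a0 # b0) z)).
Proof.
have I1 : sqint ((fun x => a x - a0 x) # b).
  have -> : (fun x => a x - a0 x) # b = (fun z => (a # b) z - (a0 # b) z).
    by apply/funext => z; rewrite mulrBl.
  exact: sqintB.
have -> : a0 # w = (fun z => E0 z - ((fun x => a x - a0 x) # b) z).
  by apply/funext => z; rewrite /E0 /w; ring.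
apply: le_trans (nrmB _ _) _ => //.
have := nrm_marginal_diff; have := nrm_E0; lra.
Qed.

Let mu' : mX u.
Proof.
by apply: measurable_funB; [exact: measurable_funB|do !apply: measurable_funM].
Qed.

Let usplit f : u # f = (fun z => (a # f) z - (a0 # f) z - h' * (sX (pi z) * (a0 # f) z)).
Proof. by apply/funext => z; rewrite /u; ring. Qed.

Let Iub0 : sqint (u # b0).
Proof. by rewrite usplit; apply: sqintB; [exact: sqintB|exact: sqintZ]. Qed.
Let Iub : sqint (u # b). Proof. exact: sqint_swap. Qed.

Let U := nrm (u # b0).

Let ua x := `|u x|.
Let mua : mX ua. Proof. exact: measurableT_comp. Qed.
Let Iuab0 : sqint (ua # b0).
Proof.
apply: le_sqint Iub0; first exact: measurable_lift.
by move=> z; rewrite /ua !normrM normr_id.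
Qed.
Let nrm_uab0 : nrm (ua # b0) = U.
Proof.
by rewrite -nrm_norm -[RHS]nrm_norm; congr (nrm _); apply/funext => z;
  rewrite !normrM normr_id.
Qed.

Let A := nrm (a0 # w).
Let tau := nrm (fun z => tail N (s z) * (a0 # b0) z).

Let Itail : sqint (fun z => tail N (s z) * (a0 # b0) z).
Proof.
apply: le_sqint Is.
  by apply: measurable_funM; [exact: measurable_tail|exact: measurable_lift].
by move=> z; rewrite !normrM ler_wpM2r// tail_le.
Qed.

Let Iclip : sqint (fun z => clip N (s z) * (a0 # b0) z).
Proof.
apply: le_sqint (sqintZ N Ia0b0).
  by apply: measurable_funM; [exact: measurable_clip|exact: measurable_lift].
by move=> z; rewrite !normrM ler_wpM2r// (ger0_norm N_ge0) clip_le.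
Qed.

(** For the clipped score the factors regroup as |u| b0 times a0 w, with norms [U] and [A]. The tail
    is unbounded and stays with a0 b0; it is paired with |u| w, whose norm is at most 2 [U]. *)
Lemma ip_score_bound :
  `|ip (ua # w) (fun z => s z * (a0 # b0) z)| <= U * (N * A + 2 * tau).
Proof.
have Iuaw := Iw mua Iuab0; have Ia0w := Iw ma0 Ia0b0.
have -> : (fun z => s z * (a0 # b0) z) =
    (fun z => clip N (s z) * (a0 # b0) z + tail N (s z) * (a0 # b0) z).
  by apply/funext => z; rewrite -mulrDl clip_tail.
rewrite ipDr//; apply: le_trans (ler_normD _ _) _; rewrite mulrDr lerD//.
  apply: (@le_trans _ _ (ip (fun z => `|(ua # b0) z|) (fun z => N * `|(a0 # w) z|))).
    apply: le_ip_norm => //; [exact: sqint_norm|exact/sqintZ/sqint_norm|].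
    move=> z; rewrite !normrM normr_id.
    have := clip_le (s z) N_ge0; move: (normr_ge0 (clip N (s z))).
    set c := `|clip _ _| => c0 cN.
    rewrite (_ : _ * _ = c * (`|ua (pi z)| * `|b0 z| * (`|a0 (pi z)| * `|w z|)));
      last by rewrite /ua normr_id; ring.
    rewrite (_ : _ * (N * _) = N * (`|ua (pi z)| * `|b0 z| * (`|a0 (pi z)| * `|w z|)));
      last by rewrite /ua normr_id; ring.
    by rewrite ler_wpM2r// !mulr_ge0.
  rewrite ipZr; try exact: sqint_norm.
  rewrite mulrCA ler_wpM2l//; apply: le_trans (ler_norm _) _.
  apply: le_trans (cauchy_schwarz (sqint_norm Iuab0) (sqint_norm Ia0w)) _.
  by rewrite !nrm_norm nrm_uab0.
apply: le_trans (cauchy_schwarz Iuaw Itail) _.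
rewrite mulrCA mulrA ler_wpM2r ?nrm_ge0//.
by have := nrm_w mua Iuab0; rewrite nrm_uab0.
Qed.

(** [U ^+ 2] is expressed by inner products each of which carries a factor [U] by Cauchy-Schwarz, so
    one factor cancels. The 3 is 1 from pairing [D] with u b0 plus 2 from pairing it with |u| w. *)
Lemma marginal_error_bound : U <= 3 * nrm D + `|h'| * (N * A + 2 * tau).
Proof.
have Iuaw := Iw mua Iuab0; have Iuw := Iw mu' Iub0.
have Iaw := Iw ma Iab0; have Ia0w := Iw ma0 Ia0b0.
have Iuab := sqint_swap mua Iuab0.
(* Write b b0 = (b^2 + b0^2 - w^2) / 2 and integrate b^2 as b0^2. *)
have key : U ^+ 2 = ip (u # b0) D + 2^-1 * ip (u # w) (a # w).
  rewrite sqr_nrm {2}usplit.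
  rewrite !Wsplit !(ipBl, ipBr)//; try exact: sqintB; try exact: sqintZ.
  rewrite !ipZr// sX_cond//.
  have -> : ip (u # b) (a # b0) = ip (u # b0) (a # b).
    by apply: eq_Rintegral => z _; ring.
  by rewrite (ip_swap mu' ma)//; lra.
(* Enlarging a to a + a0 makes the weight symmetric in the two laws, so that the next identity can
   reduce it to the joint increment [E0]. *)
have le1 : ip (u # w) (a # w) <= ip (ua # w) ((fun x => a x + a0 x) # w).
  have Isum : sqint ((fun x => a x + a0 x) # w).
    have -> : (fun x => a x + a0 x) # w = (fun z => (a # w) z + (a0 # w) z).
      by apply/funext => z; rewrite mulrDl.
    exact: sqintD.
  apply: le_ip => // z; rewrite mulrACA [leRHS]mulrACA ler_wpM2r -?expr2 ?sqr_ge0//.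
  have := ler_norm (u (pi z)); have := a_ge0 (pi z); have := a0_ge0 (pi z).
  by have := normr_ge0 (u (pi z)); rewrite /ua; nra.
(* (a + a0) w = 2 (a b - a0 b0) - (a - a0) (b + b0), and w (b + b0) = b^2 - b0^2
   is orthogonal to functions of X. *)
have eq2 : ip (ua # w) ((fun x => a x + a0 x) # w) = 2 * ip (ua # w) E0.
  pose am x := a x - a0 x.
  have mam : mX am by exact: measurable_funB.
  have amE f : am # f = (fun z => (a # f) z - (a0 # f) z).
    by apply/funext => z; rewrite mulrBl.
  have Iam : sqint (am # b) by rewrite amE; exact: sqintB.
  have Iam0 : sqint (am # b0) by rewrite amE; exact: sqintB.
  have -> : (fun x => a x + a0 x) # w = (fun z => 2 * E0 z - ((am # b) z + (am # b0) z)).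
    by apply/funext => z; rewrite /E0 /am /w; ring.
  rewrite ipBr ?ipZr//; [|exact: sqintZ|exact: sqintD].
  suff -> : ip (ua # w) (fun z => (am # b) z + (am # b0) z) = 0 by rewrite subr0.
  rewrite Wsplit ipBl ?ipDr//; try exact: sqintD.
  rewrite (ip_swap mua mam)//.
  have -> : ip (ua # b) (am # b0) = ip (ua # b0) (am # b).
    by apply: eq_Rintegral => z _; ring.
  ring.
have eq3 : ip (ua # w) E0 = ip (ua # w) D + h' * ip (ua # w) (fun z => s z * (a0 # b0) z).
  rewrite -ipZr// -ipDr//; last exact: sqintZ.
  by apply: eq_Rintegral => z _; rewrite /D /E0; ring.
have b1 : ip (u # b0) D <= U * nrm D.
  exact: le_trans (ler_norm _) (cauchy_schwarz Iub0 ID).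
have b2 : ip (ua # w) D <= 2 * U * nrm D.
  apply: le_trans (le_trans (ler_norm _) (cauchy_schwarz Iuaw ID)) _.
  by rewrite ler_wpM2r ?nrm_ge0//; have := nrm_w mua Iuab0; rewrite nrm_uab0.
have b3 : h' * ip (ua # w) (fun z => s z * (a0 # b0) z) <=
    `|h'| * (U * (N * A + 2 * tau)).
  by apply: le_trans (ler_norm _) _; rewrite normrM ler_wpM2l// ip_score_bound.
have U0 : 0 <= U := nrm_ge0 _ _.
have : U * U <= U * (3 * nrm D + `|h'| * (N * A + 2 * tau)) by move: key; rewrite expr2 => ->; lra.
have [->|Un] := eqVneq U 0; last by rewrite ler_pM2l// lt_def Un.
have D0 : 0 <= nrm D := nrm_ge0 _ _.
have A0 : 0 <= A := nrm_ge0 _ _.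
have t0 : 0 <= tau := nrm_ge0 _ _.
by move=> _; rewrite addr_ge0 ?mulr_ge0// addr_ge0 ?mulr_ge0.
Qed.

Let tauX := nrm (fun z => tail N (sX (pi z)) * (a0 # b0) z).

Let nrm_sXa0w : nrm (fun z => sX (pi z) * (a0 # w) z) <= N * A + 2 * tauX.
Proof.
pose tX x := tail N (sX x) * a0 x; pose cX x := clip N (sX x) * a0 x.
have mtX : mX tX by apply: measurable_funM => //; exact: measurable_tail.
have mcX : mX cX by apply: measurable_funM => //; exact: measurable_clip.
have mw : measurable_fun setT w by exact: measurable_funB.
have Ia0w := Iw ma0 Ia0b0.
have tXE : (fun z => tail N (sX (pi z)) * (a0 # b0) z) = tX # b0.
  by apply/funext => z; rewrite mulrA.
have ItX : sqint (tX # b0).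
  apply: le_sqint IsX; first exact: measurable_lift.
  by move=> z; rewrite /tX -mulrA normrM [leRHS]normrM ler_wpM2r// tail_le.
have bX z : `|(cX # w) z| <= `|N * (a0 # w) z|.
  by rewrite /cX -mulrA normrM [leRHS]normrM ler_wpM2r// (ger0_norm N_ge0) clip_le.
have mcw : measurable_fun setT (cX # w) by exact: measurable_lift.
have IcX : sqint (cX # w) by apply: le_sqint (sqintZ N Ia0w).
have -> : (fun z => sX (pi z) * (a0 # w) z) = (fun z => (cX # w) z + (tX # w) z).
  by apply/funext => z; rewrite /cX /tX -!mulrDl clip_tail mulrA.
apply: le_trans (nrmD _ _) _ => //; first exact: Iw.
rewrite lerD//; last by rewrite /tauX tXE; exact: nrm_w.
by apply: le_trans (le_nrm _ (sqintZ N Ia0w) bX) _ => //; rewrite nrmZ// ger0_norm.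
Qed.

Lemma conditional_dqm_bound :
  nrm (fun z => (a0 # b) z - (a0 # b0) z - h' * ((s z - sX (pi z)) * (a0 # b0) z)) <=
  4 * nrm D + `|h'| * (4 * N * (nrm D + `|h'| * nrm (fun z => s z * (a0 # b0) z))
     + 2 * tau + 2 * tauX).
Proof.
have Ia0w := Iw ma0 Ia0b0.
have IsXa0w : sqint (fun z => sX (pi z) * (a0 # w) z).
  have E f : (fun z => sX (pi z) * (a0 # f) z) = (fun x => sX x * a0 x) # f.
    by apply/funext => z; rewrite mulrA.
  by move: IsX; rewrite !E => ?; apply: (@Iw (fun x => sX x * a0 x)) => //; exact: measurable_funM.
(* The wanted error is the joint remainder, minus the marginal remainder, minus a mixed term of
   second order. *)
have -> : (fun z => (a0 # b) z - (a0 # b0) z - h' * ((s z - sX (pi z)) * (a0 # b0) z)) =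
    (fun z => D z - (u # b) z - h' * (sX (pi z) * (a0 # w) z)).
  by apply/funext => z; rewrite /D /u /w; ring.
apply: le_trans (nrmB (sqintB ID Iub) (sqintZ h' IsXa0w)) _.
rewrite nrmZ//.
have h1 := nrmB ID Iub; rewrite nrm_swap// in h1.
have h2 := marginal_error_bound.
have h3 : `|h'| * nrm (fun z => sX (pi z) * (a0 # w) z) <= `|h'| * (N * A + 2 * tauX).
  by rewrite ler_wpM2l.
have h4 : `|h'| * (N * A) <= `|h'| * (N * (2 * (nrm D + `|h'| * nrm (fun z => s z * (a0 # b0) z)))).
  by rewrite ler_wpM2l// ler_wpM2l// nrm_a0w.
rewrite -/U in h1; lra.
Qed.

End conditional_error.

(** * Conditional expectations as projections *)

(** Dominated convergence: the squared tails vanish pointwise from some level on and are bounded by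
    the square of [f]. *)
Lemma nrm_tail_small d (T : measurableType d) (R : realType)
    (P : {measure set T -> \bar R}) (f : T -> R) (e : R) :
  sqint P f -> 0 < e ->
  \forall n \near \oo, nrm P (fun z => tail n%:R (f z)) < e.
Proof.
move=> sf e0; have [mf _] := sf.
have mt n : measurable_fun setT (fun z => tail n%:R (f z)) by exact: measurable_tail.
have tle n z : `|tail n%:R (f z)| <= `|f z| by exact: tail_le.
have st n : sqint P (fun z => tail n%:R (f z)) by exact: le_sqint (mt n) (tle n) sf.
have h1 : \forall x \ae P, setT x -> (tail n%:R (f x) ^+ 2)%:E @[n --> \oo] --> (0 : \bar R)%E.
  apply: aeW => z _; apply: cvg_near_cst; near=> n.
  rewrite tail_eq0 ?expr0n//; near: n; exact: nbhs_infty_ger.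
have h2 : \forall x \ae P, forall n : nat, setT x ->
    (`|(tail n%:R (f x) ^+ 2)%:E| <= (f x ^+ 2)%:E)%E.
  apply: aeW => z n _; rewrite /= lee_fin ger0_norm ?sqr_ge0//.
  rewrite -(real_normK (num_real (f z))) -(real_normK (num_real (tail n%:R (f z)))).
  by rewrite lerXn2r ?nnegrE.
have [_ _] := dominated_convergence measurableT
  (fun n => measurable_sqr_EFin (mt n)) (@measurable_cst _ _ _ _ setT 0%E)
  h1 (sqint_integrable sf) h2.
rewrite integral0 => H.
have {H}/fine_cvgP[_ H] :
    (nrm P (fun z => tail n%:R (f z)) ^+ 2)%:E @[n --> \oo] --> (0 : R)%:E.
  apply: cvg_trans H; apply: near_eq_cvg; near=> n => /=.
  by rewrite integral_sqr.
have e2 : 0 < e ^+ 2 by rewrite exprn_gt0.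
near=> n; suff : nrm P (fun z => tail n%:R (f z)) ^+ 2 < e ^+ 2.
  by rewrite ltr_pXn2r ?nnegrE ?nrm_ge0// ltW.
near: n; exact: (cvgr_lt _ H).
Unshelve. all: by end_near. Qed.

Section conditional_expectation.
Context dX dY (X : measurableType dX) (Y : measurableType dY) (R : realType).

Lemma preimage_fst (A : set X) : (@fst X Y) @^-1` A = A `*` setT.
Proof. by apply/seteqP; split => -[x y] //= []. Qed.

(** The integral of [f] over the cylinders A x Y is a charge in A dominated by [PX]; its
    Radon-Nikodym derivative is the conditional expectation. *)
Lemma cond_expectation_ex (PX : probability X R) (K : R.-pker X ~> Y) f :
  sqint (joint PX K) f -> exists g, cond_expectation (joint PX K) f g.
Proof.
move=> sf; pose P : probability (X * Y)%type R := joint PX K.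
have if1 : P.-integrable setT (EFin \o f) by exact: sqint_integrable1.
have mfst : measurable_fun setT (@fst X Y) by exact: measurable_fst.
have mpre A : measurable A -> measurable ((@fst X Y) @^-1` A).
  by move=> mA; rewrite -[X in measurable X]setTI; exact: mfst.
pose nu0 : {charge set (X * Y)%type -> \bar R} := induced_charge if1.
pose nu1 : {charge set X -> \bar R} := pushforward nu0 (@fst X Y).
pose nu := nu1 mfst.
have nuPX : nu `<< PX.
  apply/null_content_dominatesP => A mA PA0.
  rewrite /nu /nu1 /= /pushforward /= /induced_charge.
  apply: null_set_integral; first exact: mpre.
    by apply: measurable_funTS; exact: measurable_int if1.
  by rewrite -PA0; exact: joint_fst.
pose G := Radon_Nikodym nu PX.
have iG : PX.-integrable setT G by exact: Radon_Nikodym_integrable.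
have mG : measurable_fun setT G := measurable_int _ iG.
have GE x : (fine (G x))%:E = G x by rewrite fineK//; exact: Radon_Nikodym_fin_num.
have mg : measurable_fun setT (fun x => fine (G x)) by exact: measurableT_comp mG.
pose PF : {measure set X -> \bar R} := pushforward P (@fst X Y).
have PFE A : measurable A -> PX A = PF mfst A.
  by move=> mA; exact/esym/joint_fst.
have mgE : measurable_fun setT (fun x => (fine (G x))%:E) by exact/measurable_EFinP.
have ig : P.-integrable setT (EFin \o ((fun x => fine (G x)) \o fst)).
  apply/integrableP; split; first by apply/measurable_EFinP; exact: measurableT_comp.
  have /integrableP[_] := iG; apply: le_lt_trans.
  rewrite (@eq_measure_integral _ _ _ setT (PF mfst)); last by move=> A mA _; exact: PFE.
  rewrite ge0_integral_pushforward//; last exact: measurableT_comp.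
  rewrite preimage_setT le_eqVlt; apply/orP; left; apply/eqP.
  by apply: eq_integral => z _ /=; rewrite -GE.
exists (fun x => fine (G x)); split => // A mA.
rewrite -!preimage_fst.
transitivity (nu A); last by [].
rewrite (Radon_Nikodym_integral nuPX)//.
rewrite (@eq_measure_integral _ _ _ A (PF mfst)); last by move=> B mB _; exact: PFE.
rewrite integral_pushforward//.
- by apply: eq_integral => z _ /=; rewrite GE.
- have igA : P.-integrable ((@fst X Y) @^-1` A)
      (EFin \o ((fun x => fine (G x)) \o fst)).
    by apply: integrableS ig => //; exact: mpre.
  by apply: eq_integrable igA => //; [exact: mpre|move=> z _ /=; rewrite GE].
Qed.

Variable P : probability (X * Y)%type R.
Implicit Types (f : X * Y -> R) (g k : X -> R).

Let mfst_comp k : measurable_fun setT k -> measurable_fun setT (fun z : X * Y => k z.1).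
Proof. by move=> mk; exact: measurableT_comp. Qed.

Let Iint (h : X * Y -> R) := (\int[P]_z h z)%R.

Lemma cond_expectation_ge0 f g k : measurable_fun setT f ->
  P.-integrable setT (EFin \o f) -> cond_expectation P f g ->
  measurable_fun setT k -> (forall x, 0 <= k x) ->
  P.-integrable setT (EFin \o (fun z => k z.1 * f z)) ->
  P.-integrable setT (EFin \o (fun z => k z.1 * g z.1)) ->
  Iint (fun z => k z.1 * f z) = Iint (fun z => k z.1 * g z.1).
Proof.
move=> mf intf [mg intg H] mk k0 ikf ikg.
(* Adding m makes both integrands nonnegative, so that transport applies. *)
pose m z := `|g z.1| + `|f z|.
have mm : measurable_fun setT m.
  by apply: measurable_funD; apply: measurableT_comp => //; exact: mfst_comp.
have im : P.-integrable setT (EFin \o m).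
  have := integrableD measurableT (integrable_norm intg) (integrable_norm intf).
  by apply: eq_integrable.
have ikm : P.-integrable setT (EFin \o (fun z => k z.1 * m z)).
  have := integrableD measurableT (integrable_norm ikg) (integrable_norm ikf).
  by apply: eq_integrable => // z _ /=; rewrite !normrM (ger0_norm (k0 _)) /m mulrDr.
have T := @ge0_integral_transport _ _ _ _ _ _ _ P P (@fst X Y) fst
  (fun z => f z + m z) (fun z => g z.1 + m z).
have {T} : (\int[P]_z ((k z.1)%:E * (f z + m z)%:E) =
        \int[P]_z ((k z.1)%:E * (g z.1 + m z)%:E))%E.
  apply: (T _ _ _ _ _ _ _ (fun x => (k x)%:E)) => //.
  - exact: measurable_funD.
  - by apply: measurable_funD => //; exact: mfst_comp.
  - by move=> z; rewrite /m; have := ler_norm (- f z); rewrite normrN;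
      have := normr_ge0 (g z.1); lra.
  - by move=> z; rewrite /m; have := ler_norm (- g z.1); rewrite normrN;
      have := normr_ge0 (f z); lra.
  - move=> A mA; rewrite preimage_fst.
    have mAT : measurable (A `*` [set: Y]) by exact: measurableX.
    have iS (h : X * Y -> R) : P.-integrable setT (EFin \o h) ->
        P.-integrable (A `*` setT) (EFin \o h) by exact: integrableS.
    under eq_integral do rewrite EFinD.
    under [RHS]eq_integral do rewrite EFinD.
    rewrite !integralD//; try exact: iS.
    by rewrite H.
  - exact/measurable_EFinP.
move=> E; suff : Iint (fun z => k z.1 * f z) + Iint (fun z => k z.1 * m z) =
    Iint (fun z => k z.1 * g z.1) + Iint (fun z => k z.1 * m z) by move/addIr.
rewrite /Iint -!RintegralD//.
rewrite /Rintegral; congr fine.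
under eq_integral do rewrite -mulrDr EFinM.
by under [RHS]eq_integral do rewrite -mulrDr EFinM.
Qed.

(** The orthogonal projection onto the square-integrable functions of X. [cond_expectation] tests
    against indicators and makes [g] merely integrable; this Hilbert space form behaves well under
    linear combinations and norms. *)
Definition l2_proj f g : Prop :=
  [/\ measurable_fun setT g, sqint P (fun z => g z.1) &
      forall k, measurable_fun setT k -> sqint P (fun z => k z.1) ->
        ip P (fun z => k z.1) f = ip P (fun z => k z.1) (fun z => g z.1)].

Let integrable_bounded (c : R) (h f : X * Y -> R) : 0 <= c -> measurable_fun setT h ->
  (forall z, `|h z| <= c) -> P.-integrable setT (EFin \o f) ->
  P.-integrable setT (EFin \o (fun z => h z * f z)).
Proof.
move=> c0 mh hc intf; have mf : measurable_fun setT f.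
  by apply/measurable_EFinP; exact: measurable_int intf.
apply: le_integrable (integrableZl measurableT c intf) => //.
  by apply/measurable_EFinP; exact: measurable_funM.
by move=> z _ /=; rewrite lee_fin !normrM ler_wpM2r// (ger0_norm c0).
Qed.

(** Square integrability of [g] is obtained by clipping: |gn|^2 <= <gn, g> = <gn, f> <= |gn| |f|
    gives |gn| <= |f| for all n, and monotone convergence passes this to [g]. *)
Lemma cond_expectation_proj f g : sqint P f -> cond_expectation P f g -> l2_proj f g.
Proof.
move=> sf ceg; have [mf _] := sf; have [mg intg H] := ceg.
have intf : P.-integrable setT (EFin \o f).
  exact: sqint_integrable1.
have mg1 := mfst_comp mg.
pose gn n x := clip n%:R (g x).
have mgn n : measurable_fun setT (gn n) by exact: measurable_clip.
have n0 (n : nat) : 0 <= n%:R :> R by [].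
have gnb n z : `|gn n z.1| <= n%:R by exact: clip_le.
have sgn n : sqint P (fun z => gn n z.1).
  by apply: (@sqint_bounded _ _ _ _ n%:R) => //; exact: mfst_comp.
have ign n (h : X * Y -> R) : P.-integrable setT (EFin \o h) ->
    P.-integrable setT (EFin \o (fun z => gn n z.1 * h z)).
  by apply: (integrable_bounded (n0 n)) => //; exact: mfst_comp.
have bnd n : nrm P (fun z => gn n z.1) <= nrm P f.
  have : ip P (fun z => gn n z.1) f = Iint (fun z => gn n z.1 * g z.1).
    (* [cond_expectation_ge0] needs a nonnegative weight, so [gn n] is shifted by its bound and the
       constant part is subtracted afterwards. *)
    have E : Iint (fun z => (gn n z.1 + n%:R) * f z) = Iint (fun z => (gn n z.1 + n%:R) * g z.1).
      have ib (h : X * Y -> R) : P.-integrable setT (EFin \o h) ->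
        P.-integrable setT (EFin \o (fun z => (gn n z.1 + n%:R) * h z)).
        apply: (@integrable_bounded (n%:R + n%:R)) => //.
          by apply: measurable_funD => //; exact: mfst_comp.
        move=> z; apply: le_trans (ler_normD _ _) _.
        by rewrite lerD// ger0_norm.
      apply: (cond_expectation_ge0 mf intf ceg (k := fun x => gn n x + n%:R)).
      - exact: measurable_funD.
      - by move=> x; have := clip_le (g x) (n0 n); rewrite ler_norml -/(gn n x) => /andP[]; lra.
      - exact: ib.
      - exact: (ib (fun z => g z.1)).
    have E2 : Iint (fun z => n%:R * f z) = Iint (fun z => n%:R * g z.1).
      apply: (cond_expectation_ge0 mf intf ceg (k := fun x => n%:R)) => //.
        exact: (integrableZl measurableT n%:R intf).
      exact: (integrableZl measurableT n%:R intg).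
    have S (h : X * Y -> R) : P.-integrable setT (EFin \o h) ->
        Iint (fun z => (gn n z.1 + n%:R) * h z) =
        Iint (fun z => gn n z.1 * h z) + Iint (fun z => n%:R * h z).
      move=> ih; rewrite /Iint -RintegralD//.
      - by apply: eq_Rintegral => z _; rewrite mulrDl.
      - exact: ign.
      - exact: (integrableZl measurableT n%:R ih).
    by move: E; rewrite !S// E2 => /addIr.
  move=> E.
  have h1 : nrm P (fun z => gn n z.1) ^+ 2 <= Iint (fun z => gn n z.1 * g z.1).
    rewrite sqr_nrm; apply: le_Rintegral => //; first exact: integrable_mul.
      exact: (ign n (fun z => g z.1)).
    by move=> z _; rewrite -expr2 mulrC; exact: sqr_clip_le_mul.
  have := le_trans (ler_norm _) (cauchy_schwarz (sgn n) sf); rewrite E => h2.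
  have := le_trans h1 h2; rewrite expr2.
  have [->|h0] := eqVneq (nrm P (fun z => gn n z.1)) 0; first by rewrite nrm_ge0.
  by rewrite ler_pM2l// lt_def h0 nrm_ge0.
have sg : sqint P (fun z => g z.1).
  split=> //; apply: (@le_lt_trans _ _ (nrm P f ^+ 2)%:E); last by rewrite ltry.
  have lim z : limn (fun n => (gn n z.1 ^+ 2)%:E) = (g z.1 ^+ 2)%:E.
    apply/cvg_lim => //; apply/fine_cvgP; split; first exact: nearW.
    by rewrite expr2; under eq_fun do rewrite /= expr2; apply: cvgM; exact: clip_cvg.
  under eq_integral do rewrite -lim.
  rewrite monotone_convergence//.
  - apply: lime_le.
      apply: ereal_nondecreasing_is_cvgn => p q pq.
      apply: ge0_le_integral => //; try exact: (measurable_sqr_EFin (mfst_comp (mgn _))).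
      + by move=> z _; rewrite lee_fin sqr_ge0.
      + by move=> z _; rewrite lee_fin sqr_clip_le// ler_nat.
    apply: nearW => n; rewrite integral_sqr// lee_fin lerXn2r ?nnegrE ?nrm_ge0//.
  - by move=> n; exact: (measurable_sqr_EFin (mfst_comp (mgn _))).
  - by move=> n z _; rewrite lee_fin sqr_ge0.
  - by move=> z _ p q pq; rewrite lee_fin sqr_clip_le// ler_nat.
split => // k mk sk.
have K0 (j : X -> R) : measurable_fun setT j -> (forall x, 0 <= j x) -> sqint P (fun z => j z.1) ->
    ip P (fun z => j z.1) f = ip P (fun z => j z.1) (fun z => g z.1).
  move=> mj j0 sj; apply: (cond_expectation_ge0 mf intf ceg) => //.
    exact: integrable_mul.
  exact: (integrable_mul sj sg).
(* A signed [k] is the difference of the nonnegative weights k + |k| and |k|. *)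
have ma : measurable_fun setT (fun x => `|k x|) by exact: measurableT_comp.
have sa : sqint P (fun z => `|k z.1|) by exact: sqint_norm.
have E1 := K0 _ ma (fun x => normr_ge0 _) sa.
have mD : measurable_fun setT (fun x => k x + `|k x|) by exact: measurable_funD.
have D0 x : 0 <= k x + `|k x| by have := ler_norm (- k x); rewrite normrN; lra.
have E2 := K0 _ mD D0 (sqintD sk sa).
by move: E2; rewrite !ipDl// E1 => /addIr.
Qed.

(** Pythagoras in polarized form, so that it also covers the off-diagonal entries of covariance
    matrices. *)
Lemma ip_proj_resid f1 g1 f2 g2 : sqint P f1 -> sqint P f2 ->
  l2_proj f1 g1 -> l2_proj f2 g2 ->
  ip P (fun z => f1 z - g1 z.1) (fun z => f2 z - g2 z.1) =
  ip P f1 f2 - ip P (fun z => g1 z.1) (fun z => g2 z.1).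
Proof.
move=> s1 s2 [m1 t1 p1] [m2 t2 p2].
rewrite ipBl ?ipBr//; try exact: sqintB.
by rewrite p2// (ipC _ f1 (fun z => g2 z.1)) p1// (ipC _ (fun z => g2 z.1)); lra.
Qed.

Lemma nrm_proj_resid f g : sqint P f -> l2_proj f g ->
  nrm P (fun z => f z - g z.1) <= nrm P f.
Proof.
move=> sf pf; rewrite ler_wsqrtr// (ip_proj_resid sf sf pf pf).
by rewrite gerBl ip_ge0.
Qed.

Lemma l2_projB f1 g1 f2 g2 : sqint P f1 -> sqint P f2 ->
  l2_proj f1 g1 -> l2_proj f2 g2 ->
  l2_proj (fun z => f1 z - f2 z) (fun x => g1 x - g2 x).
Proof.
move=> s1 s2 [m1 t1 p1] [m2 t2 p2]; split.
- exact: measurable_funB.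
- exact: (sqintB t1 t2).
- move=> k mk sk; by rewrite !ipBr// (p1 k mk sk) (p2 k mk sk).
Qed.

Lemma l2_proj_sum n (c : 'I_n -> R) (f : 'I_n -> X * Y -> R) (g : 'I_n -> X -> R) :
  (forall i, sqint P (f i)) -> (forall i, l2_proj (f i) (g i)) ->
  l2_proj (fun z => \sum_i c i * f i z) (fun x => \sum_i c i * g i x).
Proof.
move=> sf pf; have sg i : sqint P (fun z => g i z.1) by case: (pf i).
split.
- by apply: measurable_sum => i; apply: measurable_funM => //; case: (pf i).
- exact: (sqint_sum c sg).
- move=> k mk sk; rewrite !(ipC _ (fun z => k z.1)) ip_suml//.
  rewrite (ip_suml c sg)//; apply: eq_bigr => i _; congr (_ * _).
  by rewrite ipC; case: (pf i) => _ _ ->//; rewrite ipC.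
Qed.

End conditional_expectation.

(** Applied to scores, for which no conditional expectation is given in advance. *)
Lemma l2_proj_ex dX dY (X : measurableType dX) (Y : measurableType dY) (R : realType)
    (PX : probability X R) (K : R.-pker X ~> Y) f :
  sqint (joint PX K) f -> exists g, l2_proj (joint PX K) f g.
Proof.
move=> sf; have [g ceg] := cond_expectation_ex sf.
by exists g; apply: cond_expectation_proj.
Qed.

(** * Differentiability in quadratic mean *)

Section almost_everywhere.
Context d (T : measurableType d) (R : realType) (mu : {measure set T -> \bar R}).
Implicit Types f g : T -> R.

Lemma ae_integral_sqr f g : measurable_fun setT f -> measurable_fun setT g ->
  {ae mu, forall z, f z = g z} ->
  (\int[mu]_z (f z ^+ 2)%:E = \int[mu]_z (g z ^+ 2)%:E)%E.
Proof.
move=> mf mg fg; apply: ae_eq_integral => //; try exact: measurable_sqr_EFin.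
by apply: filterS fg => z -> _.
Qed.

Lemma ae_sqint f g : measurable_fun setT f -> measurable_fun setT g ->
  {ae mu, forall z, f z = g z} -> sqint mu f -> sqint mu g.
Proof. by move=> mf mg fg [_ h]; split => //; rewrite -(ae_integral_sqr mf mg fg). Qed.

Lemma ae_nrm f g : measurable_fun setT f -> measurable_fun setT g ->
  {ae mu, forall z, f z = g z} -> nrm mu f = nrm mu g.
Proof.
move=> mf mg fg; congr (Num.sqrt (fine _)).
have E (h : T -> R) : (\int[mu]_z (h z * h z)%:E = \int[mu]_z (h z ^+ 2)%:E)%E.
  by apply: eq_integral => z _; rewrite expr2.
by rewrite !E; exact: ae_integral_sqr.
Qed.

Lemma ae_ip f1 f2 g1 g2 : measurable_fun setT f1 -> measurable_fun setT f2 ->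
  measurable_fun setT g1 -> measurable_fun setT g2 ->
  {ae mu, forall z, f1 z = f2 z} -> {ae mu, forall z, g1 z = g2 z} ->
  ip mu f1 g1 = ip mu f2 g2.
Proof.
move=> mf1 mf2 mg1 mg2 ff gg; congr fine; apply: ae_eq_integral => //.
- by apply/measurable_EFinP; exact: measurable_funM.
- by apply/measurable_EFinP; exact: measurable_funM.
- by apply: filterS2 ff gg => z -> -> _.
Qed.

End almost_everywhere.

(** * Multiplication by the root density as an isometry from L2(P) into L2(mu) *)

Section root_density_isometry.
Context d (Z : measurableType d) (R : realType).
Variables (mu : {sigma_finite_measure set Z -> \bar R}) (P : probability Z R).
Hypothesis Pmu : P `<< mu.
Local Notation r := (rden mu P).
Implicit Types k l : Z -> R.

Let mr := measurable_rden Pmu.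

Lemma integral_sqr_mul_rden k : measurable_fun setT k ->
  (\int[mu]_z ((k z * r z) ^+ 2)%:E = \int[P]_z (k z ^+ 2)%:E)%E.
Proof.
move=> mk; rewrite -(ge0_integral_rden Pmu); last 2 first.
- exact: measurable_sqr_EFin.
- by move=> z; rewrite lee_fin sqr_ge0.
by apply: eq_integral => z _; rewrite exprMn EFinM.
Qed.

Lemma sqint_mul_rden k : measurable_fun setT k ->
  sqint mu (fun z => k z * r z) <-> sqint P k.
Proof.
move=> mk; split => -[_ h]; split => //.
- by rewrite -integral_sqr_mul_rden.
- exact: measurable_funM.
- by rewrite integral_sqr_mul_rden.
Qed.

Lemma ip_mul_rden1 k : measurable_fun setT k ->
  ip mu (fun z => k z * r z) (fun z => k z * r z) = ip P k k.
Proof.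
move=> mk; congr fine; under eq_integral do rewrite -expr2.
by under [RHS]eq_integral do rewrite -expr2; exact: integral_sqr_mul_rden.
Qed.

Lemma nrm_mul_rden k : measurable_fun setT k -> nrm mu (fun z => k z * r z) = nrm P k.
Proof. by move=> mk; rewrite /nrm ip_mul_rden1. Qed.

Lemma ip_mul_rden k l : sqint P k -> sqint P l ->
  ip mu (fun z => k z * r z) (fun z => l z * r z) = ip P k l.
Proof.
move=> sk sl; have [mk _] := sk; have [ml _] := sl.
have sk' := (sqint_mul_rden mk).2 sk; have sl' := (sqint_mul_rden ml).2 sl.
have := ip_mul_rden1 (measurable_funD mk ml).
have -> : (fun z => (k \+ l) z * r z) = (fun z => k z * r z + l z * r z).
  by apply/funext => z; rewrite mulrDl.
rewrite !(ipDl, ipDr)//; try exact: sqintD.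
rewrite !ip_mul_rden1// (ipC _ (fun z => l z * r z)) (ipC _ l k); lra.
Qed.

End root_density_isometry.

Section differentiability.
Context d (Z : measurableType d) (R : realType).
Variables (mu : {sigma_finite_measure set Z -> \bar R}).
Variables (T : set R) (t0 : R) (Pt : R -> probability Z R).
Hypotheses (Tt0 : T t0) (dom : forall t, T t -> Pt t `<< mu).

Definition dqm_err s (t : R) (z : Z) : R :=
  rden mu (Pt t) z - rden mu (Pt t0) z - (t - t0) / 2 * (s z * rden mu (Pt t0) z).

Lemma sqint_dqm_err s t : T t -> sqint (Pt t0) s -> sqint mu (dqm_err s t).
Proof.
move=> Tt ss; have [ms _] := ss.
apply: sqintB; first by apply: sqintB; apply: sqint_rden; exact: dom.
by apply: sqintZ; apply/sqint_mul_rden => //; exact: dom.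
Qed.

(** Recasts the limit of extended-real quotients as an o(|t - t0|) bound on a real norm, to which
    the triangle inequality applies. *)
Lemma dqmP s : sqint (Pt t0) s ->
  dqm mu T t0 Pt s <->
  forall e, 0 < e -> \forall t \near within T t0^', nrm mu (dqm_err s t) <= e * `|t - t0|.
Proof.
move=> ss.
pose g t := (t - t0) ^- 2 * nrm mu (dqm_err s t) ^+ 2.
have gE t : T t -> (((t - t0) ^- 2)%:E *
     \int[mu]_z ((Num.sqrt (density mu (Pt t) z) - Num.sqrt (density mu (Pt t0) z)
       - (t - t0) / 2 * s z * Num.sqrt (density mu (Pt t0) z)) ^+ 2)%:E = (g t)%:E)%E.
  move=> Tt; rewrite /g EFinM -integral_sqr; last exact: sqint_dqm_err.
  by congr (_ * _)%E; apply: eq_integral => z _; rewrite /dqm_err /rden !mulrA.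
have nT : \forall t \near within T t0^', T t by exact: withinT.
have nN : \forall t \near within T t0^', t != t0.
  have h : \forall t \near t0^', t != t0 by exact: withinT.
  exact: cvg_within h.
have lt_e t e : t != t0 -> 0 < e -> (g t < e ^+ 2) = (nrm mu (dqm_err s t) < e * `|t - t0|).
  move=> tn e0; have tp : 0 < `|t - t0| by rewrite normr_gt0 subr_eq0.
  rewrite /g -(real_normK (num_real (t - t0))) mulrC ltr_pdivrMr ?exprn_gt0//.
  by rewrite -exprMn ltr_pXn2r ?nnegrE ?nrm_ge0// mulr_ge0// ltW.
have g0 t : 0 <= g t by rewrite mulr_ge0 ?invr_ge0 ?sqr_ge0.
split=> [h e e0|h].
  have {h} : (g t)%:E @[t --> within T t0^'] --> 0%:E.
    by apply: cvg_trans h; apply: near_eq_cvg; near=> t; rewrite gE//; near: t.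
  move=> /fine_cvgP[_ h].
  near=> t; apply: ltW; rewrite -lt_e//; last by near: t.
  by near: t; apply: (cvgr_lt _ h); rewrite exprn_gt0.
apply: (@cvg_trans _ ((g t)%:E @[t --> within T t0^'])).
  by apply: near_eq_cvg; near=> t; rewrite gE//; near: t.
apply/fine_cvgP; split; first exact: nearW.
apply/cvgrPdist_lt => e e0; rewrite /=.
(* The factor 1/2 turns the non-strict bound from [h] into the strict one required here. *)
pose q := Num.sqrt e / 2.
have q0 : 0 < q by rewrite divr_gt0// sqrtr_gt0.
near=> t; rewrite sub0r normrN ger0_norm//.
have tn : t != t0 by near: t.
apply: lt_le_trans (_ : g t < (Num.sqrt e) ^+ 2) _; last by rewrite sqr_sqrtr// ltW.
rewrite lt_e ?sqrtr_gt0//; apply: le_lt_trans (_ : _ <= q * `|t - t0|) _.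
  by near: t; exact: h.
rewrite ltr_pM2r ?normr_gt0 ?subr_eq0// /q.
have : 0 < Num.sqrt e by rewrite sqrtr_gt0.
lra.
Unshelve. all: by end_near. Qed.

(** Since t0 is a limit point of [T], the filter is proper, and an eventual property holds at an
    actual parameter. *)
Lemma limit_point_near (A : set R) : limit_point T t0 ->
  (\forall t \near within T t0^', A t) -> exists t, [/\ T t, t != t0 & A t].
Proof.
move=> lT h; have [t [tn Tt At]] := lT _ h.
by exists t; split => //; apply: At.
Qed.

End differentiability.

(** * Bounds along a submodel *)

Section weighted_expansion.
Context d (Z : measurableType d) (R : realType) (mu : {measure set Z -> \bar R}).
Implicit Types f k : Z -> R.

Lemma measurable_err (f g k : Z -> R) (h : R) : measurable_fun setT f ->
  measurable_fun setT g -> measurable_fun setT k ->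
  measurable_fun setT (fun z => f z - g z - h * k z).
Proof.
by move=> mf mg mk; apply: measurable_funB; [exact: measurable_funB|exact: measurable_funM].
Qed.

Lemma sqint_mul_bounded k f C : measurable_fun setT k -> (forall z, `|k z| <= C) ->
  sqint mu f -> sqint mu (fun z => k z * f z).
Proof.
move=> mk kC sf; apply: le_sqint (sqintZ C sf).
  by apply: measurable_funM => //; case: sf.
by move=> z; rewrite !normrM ler_wpM2r//; apply: le_trans (kC _) (ler_norm _).
Qed.

Lemma nrm_mul_bounded k f C : measurable_fun setT k -> 0 <= C -> (forall z, `|k z| <= C) ->
  sqint mu f -> nrm mu (fun z => k z * f z) <= C * nrm mu f.
Proof.
move=> mk C0 kC sf; rewrite -[X in X * _](ger0_norm C0) -nrmZ//; apply: le_nrm => //.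
- by case: (sqint_mul_bounded mk kC sf).
- exact: sqintZ.
- by move=> z; rewrite !normrM ler_wpM2r// (ger0_norm C0).
Qed.

(** With e = r1 - r0, equality of the weighted integrals reads 2 <k r0, e> + <k e, e> = 0. Inserting
    e = (h / 2) s r0 + E isolates h <k r0, s r0>; what remains is linear in E or quadratic in e,
    hence o(h) when E is. *)
Lemma weighted_expansion_bound (r0 r1 s k : Z -> R) (h C : R) :
  sqint mu r0 -> sqint mu r1 -> sqint mu (fun z => s z * r0 z) ->
  measurable_fun setT k -> 0 <= C -> (forall z, `|k z| <= C) ->
  ip mu (fun z => k z * r1 z) r1 = ip mu (fun z => k z * r0 z) r0 ->
  `|h| * `|ip mu (fun z => k z * r0 z) (fun z => s z * r0 z)| <=
  2 * (C * (nrm mu r0 * nrm mu (fun z => r1 z - r0 z - h / 2 * (s z * r0 z)))) +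
  C * (`|h| / 2 * nrm mu (fun z => s z * r0 z) +
       nrm mu (fun z => r1 z - r0 z - h / 2 * (s z * r0 z))) ^+ 2.
Proof.
move=> I0 I1 Is mk C0 kC sw.
pose E z := r1 z - r0 z - h / 2 * (s z * r0 z).
pose e z := r1 z - r0 z.
have Ie : sqint mu e by exact: sqintB.
have IE : sqint mu E by apply: sqintB => //; exact: sqintZ.
have Ik f : sqint mu f -> sqint mu (fun z => k z * f z) by exact: sqint_mul_bounded.
have nk f : sqint mu f -> nrm mu (fun z => k z * f z) <= C * nrm mu f.
  by exact: nrm_mul_bounded.
rewrite -/E.
have key : h * ip mu (fun z => k z * r0 z) (fun z => s z * r0 z) =
    - (2 * ip mu (fun z => k z * r0 z) E + ip mu (fun z => k z * e z) e).
  have e1 : ip mu (fun z => k z * r0 z) e =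
      ip mu (fun z => k z * r0 z) E + h / 2 * ip mu (fun z => k z * r0 z) (fun z => s z * r0 z).
    rewrite -(ipZr _ Is (Ik _ I0)) -(ipDr IE (sqintZ _ Is) (Ik _ I0)).
    by apply: eq_Rintegral => z _; rewrite /E /e; ring.
  have e2 : ip mu (fun z => k z * r1 z) r1 = ip mu (fun z => k z * r0 z) r0
     + 2 * ip mu (fun z => k z * r0 z) e + ip mu (fun z => k z * e z) e.
    have -> : ip mu (fun z => k z * r1 z) r1 =
        ip mu (fun z => k z * r0 z + k z * e z) (fun z => r0 z + e z).
      by apply: eq_Rintegral => z _; rewrite /e; ring.
    have Ik0 := Ik _ I0; have Ike := Ik _ Ie.
    rewrite (ipDl Ik0 Ike (sqintD I0 Ie)) (ipDr I0 Ie Ik0) (ipDr I0 Ie Ike).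
    have -> : ip mu (fun z => k z * e z) r0 = ip mu (fun z => k z * r0 z) e.
      by apply: eq_Rintegral => z _; ring.
    by ring.
  by move: e2; rewrite sw e1; lra.
rewrite -normrM key normrN; apply: le_trans (ler_normD _ _) _; apply: lerD.
  rewrite normrM (ger0_norm (ler0n _ 2)) ler_wpM2l//.
  apply: le_trans (cauchy_schwarz (Ik _ I0) IE) _.
  by rewrite mulrA ler_wpM2r ?nrm_ge0// nk.
apply: le_trans (cauchy_schwarz (Ik _ Ie) Ie) _.
have ne : nrm mu e <= `|h| / 2 * nrm mu (fun z => s z * r0 z) + nrm mu E.
  have -> : e = (fun z => h / 2 * (s z * r0 z) + E z).
    by apply/funext => z; rewrite /E /e; ring.
  apply: le_trans (nrmD (sqintZ _ Is) IE) _; rewrite nrmZ//.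
  by rewrite lerD2r normrM (@ger0_norm _ 2^-1).
apply: le_trans (_ : C * nrm mu e * nrm mu e <= _).
  by rewrite ler_wpM2r ?nrm_ge0// nk.
by rewrite -mulrA ler_wpM2l// -expr2 lerXn2r ?nnegrE ?nrm_ge0// (le_trans _ ne)// nrm_ge0.
Qed.

End weighted_expansion.

(** * The expansions for joint laws *)

Section joint_submodels.
Context dX dY (X : measurableType dX) (Y : measurableType dY) (R : realType).
Variable mu : {sigma_finite_measure set (X * Y)%type -> \bar R}.
Local Notation r PX K := (rden mu (joint PX K)).

(** This is [conditional_dqm_bound] with [PX1 + PX] as reference on X. The factorizations hold
    [mu]-almost everywhere, so norms and inner products are carried over by the [ae_] lemmas, and
    then to the law at t0 by the isometry. *)
Lemma conditional_err_bound (PX PX1 : probability X R) (K K1 : R.-pker X ~> Y)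
    (s : X * Y -> R) (sX : X -> R) (h N : R) :
  joint PX K `<< mu -> joint PX1 K1 `<< mu ->
  joint PX K1 `<< mu -> joint PX1 K `<< mu ->
  sqint (joint PX K) s -> l2_proj (joint PX K) s sX -> 0 <= N ->
  nrm mu (fun z => r PX K1 z - r PX K z - h * ((s z - sX z.1) * r PX K z)) <=
  4 * nrm mu (fun z => r PX1 K1 z - r PX K z - h * (s z * r PX K z)) +
  `|h| * (4 * N * (nrm mu (fun z => r PX1 K1 z - r PX K z - h * (s z * r PX K z)) +
                   `|h| * nrm (joint PX K) s)
          + 2 * nrm (joint PX K) (fun z => tail N (s z))
          + 2 * nrm (joint PX K) (fun z => tail N (sX z.1))).
Proof.
move=> d0 d1 dQ dQ' ss pX N0.
have [ms _] := ss; have [msX isX projX] := pX.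
pose a := rden (sum_measure PX1 PX) PX1; pose a0 := rden (sum_measure PX1 PX) PX.
pose b := rden_sum mu PX1 PX K1; pose b0 := rden_sum mu PX1 PX K.
have ma : measurable_fun setT a by apply: measurable_rden; exact: dominates_suml.
have ma0 : measurable_fun setT a0 by apply: measurable_rden; exact: dominates_sumr.
have mb : measurable_fun setT b by exact: measurable_rden_sum.
have mb0 : measurable_fun setT b0 by exact: measurable_rden_sum.
have mfst1 : measurable_fun setT (@fst X Y) by exact: measurable_fst.
have mfst (k : X -> R) : measurable_fun setT k -> measurable_fun setT (fun z : X * Y => k z.1).
  by move=> mk; exact: measurableT_comp.
have mab := measurable_funM (mfst _ ma) mb.
have ma0b := measurable_funM (mfst _ ma0) mb.
have mab0 := measurable_funM (mfst _ ma) mb0.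
have ma0b0 := measurable_funM (mfst _ ma0) mb0.
have e1 : {ae mu, forall z, r PX1 K1 z = a z.1 * b z}.
  by apply: rden_factor => //; exact: dominates_suml.
have eQ : {ae mu, forall z, r PX K1 z = a0 z.1 * b z}.
  by apply: rden_factor => //; exact: dominates_sumr.
have eQ' : {ae mu, forall z, r PX1 K z = a z.1 * b0 z}.
  by apply: rden_factor => //; exact: dominates_suml.
have e0 : {ae mu, forall z, r PX K z = a0 z.1 * b0 z}.
  by apply: rden_factor => //; exact: dominates_sumr.
have [mr0 mr1 mrQ mrQ'] := And4 (measurable_rden d0) (measurable_rden d1)
  (measurable_rden dQ) (measurable_rden dQ').
have mm (k : X * Y -> R) : measurable_fun setT k -> measurable_fun setT (fun z => k z * r PX K z).
  by move=> mk; exact: measurable_funM.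
have mm0 (k : X * Y -> R) : measurable_fun setT k ->
    measurable_fun setT (fun z => k z * (a0 z.1 * b0 z)).
  by move=> mk; exact: measurable_funM.
have ek (k : X * Y -> R) : {ae mu, forall z, k z * r PX K z = k z * (a0 z.1 * b0 z)}.
  by apply: filterS e0 => z ->.
have nk (k : X * Y -> R) : measurable_fun setT k ->
    nrm mu (fun z => k z * (a0 z.1 * b0 z)) = nrm (joint PX K) k.
  by move=> mk; rewrite -(nrm_mul_rden d0 mk); apply/esym/ae_nrm; [exact: mm|exact: mm0|exact: ek].
have sk (k : X * Y -> R) : measurable_fun setT k ->
    sqint mu (fun z => k z * (a0 z.1 * b0 z)) <-> sqint (joint PX K) k.
  move=> mk; rewrite -(sqint_mul_rden d0 mk); split.
    by apply: ae_sqint; [exact: mm0|exact: mm|apply: filterS (ek k) => z ->].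
  by apply: ae_sqint; [exact: mm|exact: mm0|exact: ek].
have ipk (k l : X * Y -> R) : sqint (joint PX K) k -> sqint (joint PX K) l ->
    ip mu (fun z => k z * (a0 z.1 * b0 z)) (fun z => l z * (a0 z.1 * b0 z)) =
    ip (joint PX K) k l.
  move=> kk ll; have [mk _] := kk; have [ml _] := ll.
  rewrite -(ip_mul_rden d0 kk ll).
  by apply/esym/ae_ip; [exact: mm|exact: mm0|exact: mm|exact: mm0|exact: ek|exact: ek].
have same (k : X -> \bar R) : measurable_fun setT k -> (forall x, 0 <= k x)%E ->
    (\int[mu]_z (k z.1 * (b z ^+ 2)%:E) = \int[mu]_z (k z.1 * (b0 z ^+ 2)%:E))%E.
  by move=> mk k0; exact: ge0_integral_fst_rden_sum.
have Iab0 : sqint mu (fun z => a z.1 * b0 z).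
  by apply: ae_sqint eQ' _ => //; exact: sqint_rden.
have Ia0b0 : sqint mu (fun z => a0 z.1 * b0 z).
  by apply: ae_sqint e0 _ => //; exact: sqint_rden.
have cond (k : X -> R) : measurable_fun setT k -> sqint mu (fun z => k z.1 * b0 z) ->
    ip mu (fun z => k z.1 * b0 z) (fun z => s z * (a0 z.1 * b0 z)) =
    ip mu (fun z => k z.1 * b0 z) (fun z => sX z.1 * (a0 z.1 * b0 z)).
  (* k' = 0 where a0 = 0, because division by 0 gives 0. *)
  move=> mk Ik; pose k' x := k x / a0 x.
  have mk' : measurable_fun setT k'.
    apply: measurable_funM => //.
    rewrite (_ : (fun x => _) = (fun x => a0 x `^ (-1))).
      exact: measurableT_comp (measurable_powR _) ma0.
    by apply/funext => x; rewrite powR_inv1// rden_ge0.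
  have k'E x : k' x * a0 x * a0 x = k x * a0 x.
    rewrite /k'; have [->|h0] := eqVneq (a0 x) 0; first by rewrite !mulr0.
    by rewrite divfK.
  have sk' : sqint (joint PX K) (fun z => k' z.1).
    apply/(sk _ (mfst _ mk')); apply: le_sqint Ik; first exact: (mm0 _ (mfst _ mk')).
    move=> z; rewrite mulrA [leLHS]normrM [leRHS]normrM ler_wpM2r// /k'.
    have [->|h0] := eqVneq (a0 z.1) 0; first by rewrite mulr0 normr0.
    by rewrite divfK.
  have E (l : X * Y -> R) : ip mu (fun z => k z.1 * b0 z) (fun z => l z * (a0 z.1 * b0 z)) =
      ip mu (fun z => k' z.1 * (a0 z.1 * b0 z)) (fun z => l z * (a0 z.1 * b0 z)).
    apply: eq_Rintegral => z _; have := k'E z.1 => e.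
    rewrite (_ : k z.1 * _ * _ = k z.1 * a0 z.1 * (l z * b0 z ^+ 2)); last by ring.
    by rewrite -e; ring.
  by rewrite !E (ipk (fun z => k' z.1))// (ipk (fun z => k' z.1))// projX.
have age0 x : 0 <= a x by exact: rden_ge0.
have a0ge0 x : 0 <= a0 x by exact: rden_ge0.
have := conditional_dqm_bound mfst1 mb mb0 same h ma ma0 msX ms
  age0 a0ge0 N0 Iab0 Ia0b0
  ((sk _ ms).2 ss) ((sk _ (mfst _ msX)).2 isX) cond.
have mt := measurable_tail N ms; have mtX := mfst _ (measurable_tail N msX).
rewrite (nk _ ms) (nk _ mt) (nk _ mtX).
have -> : nrm mu (fun z => a0 z.1 * b z - a0 z.1 * b0 z - h * ((s z - sX z.1) * (a0 z.1 * b0 z))) =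
    nrm mu (fun z => r PX K1 z - r PX K z - h * ((s z - sX z.1) * r PX K z)).
  have msd : measurable_fun setT (fun z => s z - sX z.1).
    by apply: measurable_funB => //; exact: mfst.
  apply: ae_nrm.
  - exact: (measurable_err h ma0b ma0b0 (mm0 _ msd)).
  - exact: (measurable_err h mrQ mr0 (mm _ msd)).
  - by apply: filterS2 eQ e0 => z -> ->.
have -> : nrm mu (fun z => a z.1 * b z - a0 z.1 * b0 z - h * (s z * (a0 z.1 * b0 z))) =
    nrm mu (fun z => r PX1 K1 z - r PX K z - h * (s z * r PX K z)).
  apply: ae_nrm.
  - exact: (measurable_err h mab ma0b0 (mm0 _ ms)).
  - exact: (measurable_err h mr1 mr0 (mm _ ms)).
  - by apply: filterS2 e1 e0 => z -> ->.
by [].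
Qed.

Lemma fixed_marginal_expansion (PX : probability X R) (K K1 : R.-pker X ~> Y)
    (s : X * Y -> R) (k : X -> R) (h C : R) :
  joint PX K `<< mu -> joint PX K1 `<< mu ->
  sqint (joint PX K) s -> measurable_fun setT k -> 0 <= C -> (forall x, `|k x| <= C) ->
  `|h| * `|ip (joint PX K) (fun z => k z.1) s| <=
  2 * (C * (nrm mu (r PX K) *
    nrm mu (fun z => r PX K1 z - r PX K z - h / 2 * (s z * r PX K z)))) +
  C * (`|h| / 2 * nrm (joint PX K) s +
    nrm mu (fun z => r PX K1 z - r PX K z - h / 2 * (s z * r PX K z))) ^+ 2.
Proof.
move=> d0 d1 ss mk C0 kC; have [ms _] := ss.
have mr0 := measurable_rden d0; have mr1 := measurable_rden d1.
have I0 := sqint_rden d0; have I1 := sqint_rden d1.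
have mfst1 : measurable_fun setT (@fst X Y) by exact: measurable_fst.
have mkf : measurable_fun setT (fun z : X * Y => k z.1).
  exact: (measurableT_comp mk mfst1).
have Is := (sqint_mul_rden d0 ms).2 ss.
have kC1 (z : X * Y) : `|k z.1| <= C by exact: kC.
have Ik := sqint_mul_bounded mkf kC1 I0.
have Isk := (sqint_mul_rden d0 mkf).1 Ik.
rewrite -(ip_mul_rden d0 Isk ss) -(nrm_mul_rden d0 ms).
have same (j : X -> \bar R) : measurable_fun setT j -> (forall x, 0 <= j x)%E ->
    (\int[mu]_z (j z.1 * (r PX K1 z ^+ 2)%:E) = \int[mu]_z (j z.1 * (r PX K z ^+ 2)%:E))%E.
  move=> mj j0.
  have mj1 : measurable_fun setT (fun z : X * Y => j z.1).
    exact: (measurableT_comp mj mfst1).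
  have j01 (z : X * Y) : (0 <= j z.1)%E by exact: j0.
  rewrite (ge0_integral_rden d1 mj1 j01) (ge0_integral_rden d0 mj1 j01).
  rewrite !(joint_ge0_integral _ _ measurableT mj j0).
  have KT (L : R.-pker X ~> Y) x : L x (xsection setT x) = 1%E.
    by rewrite xsectionE preimage_setT prob_kernel.
  by apply: eq_integral => x _; rewrite !KT.
have m1 : measurable_fun setT (fun _ : X => 1 : R) by [].
(* Against the constant 1, the swap says that the integral of [k] is the same under both laws. *)
have sw := @ip_swap _ _ _ _ _ mu fst _ _ mfst1 mr1 same k (fun=> 1) mk m1 Ik.
have E1 (f : X * Y -> R) : (fun z => 1 * f z) = f by apply/funext => z; rewrite mul1r.
rewrite !E1 in sw.
exact: (weighted_expansion_bound h I0 I1 Is mkf C0 kC1 (sw I0)).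
Qed.

End joint_submodels.

(** * Scores of the reduced model *)

(** All fields other than the set function are proofs packed in mixin records, so proof irrelevance
    applies after opening each record. *)
Lemma probability_eq d (T : measurableType d) (R : realType) (P Q : probability T R) :
  (P : set T -> \bar R) = Q -> P = Q.
Proof.
case: P => p [m1 m2 m3 m4 m5 m6 m7]; case: Q => q [n1 n2 n3 n4 n5 n6 n7] /= E.
subst q.
have E1 : n1 = m1.
  case: (n1) => ? ?; case: (m1) => ? ?.
  by congr measure_function.isContent.Axioms_; exact: Prop_irrelevance.
subst n1.
have E2 : n2 = m2.
  case: (n2) => ?; case: (m2) => ?.
  by congr measure_function.Content_isMeasure.Axioms_; exact: Prop_irrelevance.
subst n2.
have E3 : n3 = m3 by case: (n3) => ?; case: (m3) => ?; f_equal; exact: Prop_irrelevance.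
have E4 : n4 = m4 by case: (n4) => ?; case: (m4) => ?; f_equal; exact: Prop_irrelevance.
have E5 : n5 = m5 by case: (n5) => ?; case: (m5) => ?; f_equal; exact: Prop_irrelevance.
have E6 : n6 = m6 by case: (n6) => ?; case: (m6) => ?; f_equal; exact: Prop_irrelevance.
have E7 : n7 = m7 by case: (n7) => ?; case: (m7) => ?; f_equal; exact: Prop_irrelevance.
by subst n3 n4 n5 n6 n7.
Qed.

(* product_model only asks for equality of the underlying set functions. *)
Lemma product_modelP dX dY (X : measurableType dX) (Y : measurableType dY) (R : realType)
    (MX : set (probability X R)) (MYX : set (R.-pker X ~> Y))
    (P : probability (X * Y)%type R) : product_model MX MYX P ->
  exists PX K, [/\ MX PX, MYX K & P = (joint PX K : probability (X * Y)%type R)].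
Proof.
by move=> [PX [K [MXP MYK PE]]]; exists PX, K; split => //; exact: probability_eq.
Qed.

Section L20.
Context d (Z : measurableType d) (R : realType) (P : probability Z R).
Implicit Types f g : Z -> R.

Lemma Lnorm2_nrm f : sqint P f -> ('N[P]_2%:E[EFin \o f] = (nrm P f)%:E)%E.
Proof.
move=> sf; rewrite unlock.
have -> : (\int[P]_x `|(EFin \o f) x| `^ 2 = (nrm P f ^+ 2)%:E)%E.
  rewrite -integral_sqr//; apply: eq_integral => z _ /=.
  by rewrite powR_mulrn// real_normK// num_real.
by rewrite poweR_EFin powR12_sqrt ?sqr_ge0// sqrtr_sqr ger0_norm ?nrm_ge0.
Qed.

Lemma Lfun2_sqint f : f \in Lfun P 2%:E <-> sqint P f.
Proof.
split=> [Lf|sf].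
  have mf : measurable_fun setT f.
    by move: Lf; rewrite inE => /andP[+ _]; rewrite inE.
  split => //; have /integrableP[_] := Lfun2_integrable_sqr Lf.
  by under eq_integral do rewrite /= ger0_norm ?sqr_ge0//.
rewrite inE; apply/andP; split; rewrite inE/=; first by case: sf.
by rewrite /finite_norm Lnorm2_nrm// ltry.
Qed.

Lemma expectation_ip f g : sqint P f -> sqint P g ->
  ('E_P[fun z => (f z * g z)%R] = (ip P f g)%:E)%E.
Proof.
move=> sf sg; rewrite unlock /ip /Rintegral fineK//.
by apply: integrable_fin_num => //; exact: integrable_mul.
Qed.

(** Written as an inner product with 1, so that testing a projection against constants compares
    means. *)
Definition mean f : R := ip P (fun=> 1) f.

Lemma expectation_mean f : sqint P f -> ('E_P[f] = (mean f)%:E)%E.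
Proof.
move=> sf; rewrite -expectation_ip//; last exact: sqint_cst.
by congr expectation; apply/funext => z; rewrite mul1r.
Qed.

Lemma L20P f : L20 P f <-> sqint P f /\ mean f = 0.
Proof.
split=> [[/Lfun2_sqint sf]|[sf mf0]].
  by rewrite expectation_mean// => -[].
by split; [exact/Lfun2_sqint|rewrite expectation_mean// mf0].
Qed.

Lemma covariance_ip f g : sqint P f -> sqint P g -> mean f = 0 -> mean g = 0 ->
  fine (covariance P f g) = ip P f g.
Proof.
move=> sf sg mf mg; rewrite covariance.unlock.
rewrite (expectation_mean sf) (expectation_mean sg) mf mg /=.
rewrite (_ : _ * _ = (fun z => f z * g z)); first by rewrite expectation_ip.
by apply/funext => z; transitivity ((f z - 0) * (g z - 0)) => //; rewrite !subr0.
Qed.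

End L20.

Lemma small_eq0 (R : realType) (B c : R) : 0 <= c ->
  (forall e, 0 < e -> e <= 1 -> `|B| <= e * c) -> B = 0.
Proof.
move=> c0 h; apply/eqP; rewrite -normr_le0; apply/ler_addgt0Pr => e e0; rewrite add0r.
have c1 : 0 < c + 1 by lra.
(* [c] may be 0, hence the division by c + 1. *)
have q0 : 0 < Num.min 1 (e / (c + 1)) by rewrite lt_min ltr01 divr_gt0.
apply: le_trans (h _ q0 _) _; first by rewrite ge_min lexx.
apply: le_trans (_ : e / (c + 1) * c <= _).
  by rewrite ler_wpM2r// ge_min lexx orbT.
rewrite mulrAC ler_pdivrMr// ler_wpM2l//; lra.
Qed.

Lemma near_small (R : realType) (T : set R) (t0 e : R) : 0 < e ->
  \forall t \near within T t0^', `|t - t0| <= e.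
Proof.
move=> e0; have h : \forall t \near t0, `|t - t0| <= e.
  by apply/nbhs_ballP; exists e => //= t; rewrite /ball/= distrC => /ltW.
have h' : \forall t \near t0^', `|t - t0| <= e by exact: cvg_within h.
exact: cvg_within h'.
Qed.

Section product_models.
Context dX dY (X : measurableType dX) (Y : measurableType dY) (R : realType).
Variables (mu : {sigma_finite_measure set (X * Y)%type -> \bar R}).
Variables (MX : set (probability X R)) (MYX : set (R.-pker X ~> Y)).
Variables (PX : probability X R) (K : R.-pker X ~> Y).
Let M := product_model MX MYX.
Let Mred := product_model [set PX] MYX.
Let P0 : probability (X * Y)%type R := joint PX K.
Hypotheses (dom : forall P, M P -> P `<< mu) (MXPX : MX PX) (MYXK : MYX K).

Lemma reduced_model_sub P : Mred P -> M P.
Proof. by move=> [PX' [K' [PXE MK PE]]]; exists PX', K'; split => //; rewrite PXE. Qed.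

Let MP0 : M P0. Proof. by exists PX, K. Qed.
Let MredP0 : Mred P0. Proof. by exists PX, K. Qed.

Lemma reduced_score_bounded_orthogonal T t0 Pt s (k : X -> R) C :
  regular_submodel mu Mred P0 T t0 Pt s -> measurable_fun setT k -> 0 <= C ->
  (forall x, `|k x| <= C) -> ip P0 (fun z => k z.1) s = 0.
Proof.
move=> [[Tt0 lT] MPt Pt0 /L20P[ss _] hdqm] mk C0 kC.
have domt t : T t -> Pt t `<< mu by move=> /MPt/reduced_model_sub/dom.
have st0 : sqint (Pt t0) s by rewrite Pt0.
have {}hdqm := (dqmP Tt0 domt st0).1 hdqm.
pose rho := nrm mu (rden mu P0); pose S := nrm P0 s.
have rho0 : 0 <= rho := nrm_ge0 _ _; have S0 : 0 <= S := nrm_ge0 _ _.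
(* For t with error at most e h and h = |t - t0| <= e <= 1, the two terms of the expansion are at
   most e h times the two summands of this constant; dividing by h gives the claim. *)
apply: (@small_eq0 _ _ (2 * (C * rho) + C * (S / 2 + 1) ^+ 2)).
  by rewrite addr_ge0//; apply: mulr_ge0 => //; [exact: mulr_ge0|exact: sqr_ge0].
move=> e e0 e1.
have /(limit_point_near lT)[t [Tt tn [herr hsmall]]] : \forall t \near within T t0^',
    nrm mu (dqm_err mu t0 Pt s t) <= e * `|t - t0| /\ `|t - t0| <= e.
  by apply: filterI; [exact: hdqm|exact: near_small].
have [PX' [K1 [PX'E MK1 PtE]]] := product_modelP (MPt _ Tt).
have {}PX'E : PX' = PX by [].
rewrite PX'E in PtE.
have d1 : joint PX K1 `<< mu by apply: dom; exists PX, K1.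
have := fixed_marginal_expansion (t - t0) (dom MP0) d1 ss mk C0 kC.
move: herr; rewrite /dqm_err PtE Pt0 -/rho -/S.
set d := nrm mu _; set B := ip _ _ _ => dle.
have tp : 0 < `|t - t0| by rewrite normr_gt0 subr_eq0.
move: tp hsmall dle; set h := `|t - t0| => hp hsmall dle H.
rewrite -(ler_pM2l hp); apply: le_trans H _.
have d0 : 0 <= d := nrm_ge0 _ _.
have b1 : C * (rho * d) <= C * (rho * (e * h)) by rewrite ler_wpM2l// ler_wpM2l.
have b2 : (h / 2 * S + d) ^+ 2 <= h * e * (S / 2 + 1) ^+ 2.
  apply: le_trans (_ : (h * (S / 2 + 1)) ^+ 2 <= _).
    have h0 := ltW hp; have hS : 0 <= h * S by exact: mulr_ge0.
    have eh : e * h <= 1 * h by rewrite ler_wpM2r.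
    have le1 : h / 2 * S + d <= h * (S / 2 + 1) by lra.
    have ge1 : 0 <= h / 2 * S + d by lra.
    by rewrite lerXn2r ?nnegrE// (le_trans ge1).
  by rewrite exprMn ler_wpM2r ?sqr_ge0// expr2 ler_wpM2l// ltW.
have b3 : C * (h / 2 * S + d) ^+ 2 <= C * (h * e * (S / 2 + 1) ^+ 2) by rewrite ler_wpM2l.
lra.
Qed.

(** Bounded functions of X are dense: the clipped part of [k] is orthogonal to [s], and the tail is
    small in L2. *)
Lemma reduced_score_orthogonal T t0 Pt s (k : X -> R) :
  regular_submodel mu Mred P0 T t0 Pt s -> measurable_fun setT k ->
  sqint P0 (fun z => k z.1) -> ip P0 (fun z => k z.1) s = 0.
Proof.
move=> reg mk sk; have [_ _ _ /L20P[ss _] _] := reg.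
have mfst (j : X -> R) : measurable_fun setT j -> measurable_fun setT (fun z : X * Y => j z.1).
  by move=> mj; exact: (measurableT_comp mj measurable_fst).
apply: (@small_eq0 _ _ (nrm P0 s)); first exact: nrm_ge0.
move=> e e0 e1.
have [n hn] : exists n : nat, nrm P0 (fun z => tail n%:R (k z.1)) < e.
  by have /filter_ex[n hn] := nrm_tail_small sk e0; exists n.
have sc : sqint P0 (fun z => clip n%:R (k z.1)).
  apply: (@sqint_bounded _ _ _ P0 n%:R); first exact: (mfst _ (measurable_clip _ mk)).
  by move=> z; exact: clip_le.
have st : sqint P0 (fun z => tail n%:R (k z.1)).
  apply: le_sqint sk; first exact: (mfst _ (measurable_tail _ mk)).
  by move=> z; exact: tail_le.
have -> : (fun z : X * Y => k z.1) =
    (fun z => clip n%:R (k z.1) + tail n%:R (k z.1)).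
  by apply/funext => z; rewrite clip_tail.
rewrite ipDl//.
rewrite (reduced_score_bounded_orthogonal reg (k := fun x => clip n%:R (k x)) (C := n%:R))//.
- rewrite add0r; apply: le_trans (cauchy_schwarz st ss) _.
  by rewrite ler_wpM2r ?nrm_ge0// ltW.
- exact: measurable_clip.
- by move=> x; exact: clip_le.
Qed.

Lemma mean_proj_resid s sX : sqint P0 s -> l2_proj P0 s sX ->
  mean P0 (fun z => s z - sX z.1) = 0.
Proof.
move=> ss [msX isX projX]; rewrite /mean ipBr//; last exact: sqint_cst.
by rewrite (projX (fun=> 1))// ?subrr//; exact: sqint_cst.
Qed.

(** The witness keeps [PX] fixed and takes over the kernel of each [Pt t]. Kernels are picked
    separately for each t; the only link between them is the error bound. *)
Lemma conditional_score s sX : is_score mu M P0 s -> l2_proj P0 s sX ->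
  is_score mu Mred P0 (fun z => s z - sX z.1).
Proof.
move=> [T [t0 [Pt [[Tt0 lT] MPt Pt0 /L20P[ss ms0] hdqm]]]] pX.
have [msX isX projX] := pX.
have domt t : T t -> Pt t `<< mu by move=> /MPt/dom.
have st0 : sqint (Pt t0) s by rewrite Pt0.
have {}hdqm := (dqmP Tt0 domt st0).1 hdqm.
(* At t0 take P0 itself: the marginal of Pt t0 agrees with PX on measurable
   sets only, so joint PX K1 need not equal P0 as a set function. *)
have /choice[Q HQ] : forall t, exists Qt : probability (X * Y)%type R, T t ->
    [/\ Mred Qt, t = t0 -> Qt = P0 & t <> t0 -> forall N, 0 <= N ->
    nrm mu (fun z => rden mu Qt z - rden mu P0 z -
        (t - t0) / 2 * ((s z - sX z.1) * rden mu P0 z)) <=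
    4 * nrm mu (dqm_err mu t0 Pt s t) +
    `|(t - t0) / 2| * (4 * N * (nrm mu (dqm_err mu t0 Pt s t) +
        `|(t - t0) / 2| * nrm P0 s)
      + 2 * nrm P0 (fun z => tail N (s z))
      + 2 * nrm P0 (fun z => tail N (sX z.1)))].
  move=> t; have [Tt|nTt] := pselect (T t); last by exists P0.
  have [->|tn] := pselect (t = t0); first by exists P0.
  have [PX1 [K1 [MPX1 MK1 PtE]]] := product_modelP (MPt _ Tt).
  exists (joint PX K1) => _; split => //; first by exists PX, K1.
  move=> _ N N0; rewrite /dqm_err PtE Pt0.
  apply: conditional_err_bound => //; apply: dom.
  - exact: MP0.
  - by exists PX1, K1.
  - by exists PX, K1.
  - by exists PX1, K.
have Qt0 : Q t0 = P0 by have [_ h _] := HQ _ Tt0; exact: h.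
have sd : sqint P0 (fun z => s z - sX z.1) by exact: sqintB.
exists T, t0, Q; split => //.
- by move=> t /HQ[].
- by apply/L20P; split => //; exact: mean_proj_resid.
- have domQ t : T t -> Q t `<< mu by move=> /HQ[/reduced_model_sub/dom].
  apply/(dqmP Tt0 domQ); first by rewrite Qt0.
  move=> e e0; rewrite /dqm_err Qt0.
  pose S := nrm P0 s; have S0 : 0 <= S := nrm_ge0 _ _.
  (* The two tails enter with total weight (h / 2) (2 + 2), where h = |t - t0|, so they cost at most
     h e / 4. *)
  have e8 : 0 < e / 8 by rewrite divr_gt0.
  have [n [hn1 hn2]] : exists n : nat, nrm P0 (fun z => tail n%:R (s z)) < e / 8 /\
      nrm P0 (fun z => tail n%:R (sX z.1)) < e / 8.
    have /filter_ex[n hn] : \forall n \near \oo,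
        nrm P0 (fun z => tail n%:R (s z)) < e / 8 /\
        nrm P0 (fun z => tail n%:R (sX z.1)) < e / 8.
      by apply: filterI; exact: nrm_tail_small.
    by exists n.
  pose N : R := n%:R; have N0 : 0 <= N by [].
  (* After both the relative error and |t - t0| are bounded by q, the remaining terms add up to h q
     c. Taking q c <= e / 2 leaves a total of at most 3 h e / 4. *)
  pose c := 4 + 2 * N * (1 + S).
  have c0 : 0 < c by rewrite /c ltr_wpDr// ?mulr_ge0// addr_ge0.
  pose q := Num.min 1 (e / 2 / c).
  have q0 : 0 < q by rewrite lt_min ltr01 !divr_gt0.
  have q1 : q <= 1 by rewrite ge_min lexx.
  have qc : q * c <= e / 2 by rewrite -ler_pdivlMr// ge_min lexx orbT.
  have nT : \forall t \near within T t0^', T t by exact: withinT.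
  have nN : \forall t \near within T t0^', t != t0.
    have h : \forall t \near t0^', t != t0 by exact: withinT.
    exact: cvg_within h.
  near=> t.
  have Tt : T t by near: t.
  have tn : t <> t0 by apply/eqP; near: t.
  have [_ _ /(_ tn N N0)] := HQ _ Tt.
  have derr : nrm mu (dqm_err mu t0 Pt s t) <= q * `|t - t0|.
    by near: t; exact: hdqm.
  have hs : `|t - t0| <= q by near: t; exact: near_small.
  move: derr; set d := nrm mu (dqm_err _ _ _ _ _) => derr H; apply: le_trans H _.
  have d0 : 0 <= d := nrm_ge0 _ _.
  have -> : `|(t - t0) / 2| = `|t - t0| / 2 by rewrite normrM (@ger0_norm _ 2^-1).
  move: derr hs (normr_ge0 (t - t0)); set h := `|t - t0| => derr hs h0.
  have b1 : d + h / 2 * S <= q * (1 + S).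
    have : q * h <= 1 * q by rewrite ler_pM// ltW.
    have : h * S <= q * S by rewrite ler_wpM2r.
    have : 0 <= q * S by rewrite mulr_ge0// ltW.
    lra.
  have b2 : 4 * N * (d + h / 2 * S) <= 4 * N * (q * (1 + S)).
    by rewrite ler_wpM2l// mulr_ge0.
  apply: le_trans (_ : 4 * (q * h) +
    h / 2 * (4 * N * (q * (1 + S)) + 2 * (e / 8) + 2 * (e / 8)) <= _).
    apply: lerD; first by rewrite ler_wpM2l.
    rewrite ler_wpM2l ?divr_ge0//.
    move: b2 (ltW hn1) (ltW hn2); rewrite -/N -/S; lra.
  have : h * (q * c) <= h * (e / 2) by rewrite ler_wpM2l.
  have : 0 <= h * e by rewrite mulr_ge0// ltW.
  rewrite /c; lra.
Unshelve. all: by end_near. Qed.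

End product_models.

(** * Influence functions *)

Section vector_valued.
Context d (Z : measurableType d) (R : realType) (P : probability Z R) (p : nat).
Implicit Types (f : Z -> 'cV[R]_p) (a : 'cV[R]_p).

Lemma vL20P f : vL20 P f <->
  forall i, sqint P (fun z => f z i 0) /\ mean P (fun z => f z i 0) = 0.
Proof.
split=> [[mf f2 f0] i|H].
  have sf : sqint P (fun z => f z i 0).
    split; first exact: mf; apply: le_lt_trans f2; rewrite unlock.
    apply: ge0_le_integral => //.
    - by move=> z _; rewrite lee_fin sqr_ge0.
    - exact: measurable_sqr_EFin.
    - apply/measurable_EFinP; apply: measurable_sum => j.
      exact: measurable_funX.
    - move=> z _; rewrite lee_fin (bigD1 i)//= lerDl sumr_ge0// => j _.
      exact: sqr_ge0.
  by split => //; have := f0 i; rewrite expectation_mean// => -[].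
split=> [i||i]; last 1 first.
- by have [sf mf] := H i; rewrite expectation_mean// mf.
- by have [[mf _] _] := H i.
have mf2 i : measurable_fun setT (fun z => (f z i 0 ^+ 2)%:E).
  by apply: measurable_sqr_EFin; have [[mf _] _] := H i.
rewrite unlock; under eq_integral do rewrite -sumEFin.
rewrite ge0_integral_sum//; last by move=> i z _; rewrite lee_fin sqr_ge0.
by apply: lte_sum_pinfty => i _; have [[_ h] _] := H i.
Qed.

Lemma row_mulE a f z : (a^T *m f z) 0 0 = \sum_i a i 0 * f z i 0.
Proof. by rewrite mxE; apply: eq_bigr => i _; rewrite mxE. Qed.

Lemma covmx_ip f : vL20 P f ->
  covmx P f = \matrix_(i, j) ip P (fun z => f z i 0) (fun z => f z j 0).
Proof.
move=> /vL20P H; apply/matrixP => i j; rewrite !mxE.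
by have [si mi] := H i; have [sj mj] := H j; exact: covariance_ip.
Qed.

(** The quadratic form at [a] is the squared L2 norm of the combination of the components of [f]
    with coefficients [a]. *)
Lemma psd_covmx f : vL20 P f -> psdmx (covmx P f).
Proof.
move=> Hf; rewrite covmx_ip//; have H := (vL20P f).1 Hf; split.
  by apply/matrixP => i j; rewrite !mxE ipC.
move=> a; have sf i : sqint P (fun z => f z i 0) by case: (H i).
have -> : (a^T *m (\matrix_(i, j) ip P (fun z => f z i 0) (fun z => f z j 0)) *m a) 0 0 =
    ip P (fun z => \sum_i a i 0 * f z i 0) (fun z => \sum_i a i 0 * f z i 0).
  have ss := sqint_sum (fun i => a i 0) sf.
  rewrite (ip_suml (fun i => a i 0) sf ss) mxE.
  under [RHS]eq_bigr do rewrite ipC (ip_suml (fun i => a i 0) sf)//.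
  under [LHS]eq_bigr do rewrite mxE mulr_suml.
  rewrite exchange_big; apply: eq_bigr => i _; rewrite mulr_sumr.
  by apply: eq_bigr => j _; rewrite !mxE (ipC _ (fun z => f z j 0)); ring.
exact: ip_ge0.
Qed.

End vector_valued.

Section reduced_influence_function.
Context dX dY (X : measurableType dX) (Y : measurableType dY) (R : realType) (p : nat).
Variables (mu : {sigma_finite_measure set (X * Y)%type -> \bar R}).
Variables (MX : set (probability X R)) (MYX : set (R.-pker X ~> Y)).
Variables (PX : probability X R) (K : R.-pker X ~> Y).
Let M := product_model MX MYX.
Let Mred := product_model [set PX] MYX.
Let P0 : probability (X * Y)%type R := joint PX K.
Hypotheses (dom : forall P, M P -> P `<< mu) (MXPX : MX PX) (MYXK : MYX K).
Variables (theta : probability (X * Y)%type R -> 'cV[R]_p).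
Variables (varphi : X * Y -> 'cV[R]_p) (phi : X -> 'cV[R]_p).
Hypothesis vvarphi : vL20 P0 varphi.
Hypothesis phi_proj : forall i, l2_proj P0 (fun z => varphi z i 0) (fun x => phi x i 0).
Let D z := varphi z - phi z.1.

Let DE i : (fun z => D z i 0) = (fun z => varphi z i 0 - phi z.1 i 0).
Proof. by apply/funext => z; rewrite !mxE. Qed.

Let sv i : sqint P0 (fun z => varphi z i 0).
Proof. by have [] := (vL20P _ _).1 vvarphi i. Qed.

Let sp i : sqint P0 (fun z => phi z.1 i 0).
Proof. by have [] := phi_proj i. Qed.

Lemma vL20_resid : vL20 P0 D.
Proof.
apply/vL20P => i; rewrite DE; split; first exact: sqintB.
exact: (mean_proj_resid (sv i) (phi_proj i)).
Qed.

Lemma vL20_proj : vL20 P0 (fun z => phi z.1).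
Proof.
apply/vL20P => i; split => //.
have [_ <-] := (vL20P _ _).1 vvarphi i.
have [_ _ h] := phi_proj i; rewrite /mean (h (fun=> 1))//; exact: sqint_cst.
Qed.

Lemma covmx_resid : covmx P0 D = covmx P0 varphi - covmx P0 (fun z => phi z.1).
Proof.
rewrite (covmx_ip vL20_resid) (covmx_ip vvarphi) (covmx_ip vL20_proj).
apply/matrixP => i j; rewrite !mxE !DE.
exact: (ip_proj_resid (sv i) (sv j) (phi_proj i) (phi_proj j)).
Qed.

(** A submodel of the reduced model is one of the full model with the same score, so the derivative
    is already known; the correction by phi pairs to 0 with that score. *)
Lemma gradient_resid : gradient mu M P0 theta varphi -> gradient mu Mred P0 theta D.
Proof.
move=> [_ grad]; split; first exact: vL20_resid.
move=> T t0 Pt s reg; have [lT MPt Pt0 Ls hdqm] := reg.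
have regM : regular_submodel mu M P0 T t0 Pt s.
  by split => // t /MPt; exact: reduced_model_sub.
have := grad _ _ _ _ regM.
suff -> : (\col_i fine 'E_P0[fun z => (varphi z i 0 * s z)%R]%E) =
   (\col_i fine 'E_P0[fun z => (D z i 0 * s z)%R]%E) by [].
have [ss _] := (L20P _ _).1 Ls.
apply/matrixP => i j; rewrite !mxE.
have sD : sqint P0 (fun z => D z i 0) by rewrite DE; exact: sqintB.
rewrite !expectation_ip//= DE ipBl//.
have [mphi _ _] := phi_proj i.
have -> : ip P0 (fun z => phi z.1 i 0) s = 0.
  exact: (reduced_score_orthogonal dom MXPX MYXK reg mphi (sp i)).
by rewrite subr0.
Qed.

(** The map f -> f - E[f | X] is linear and does not increase norms, so the residuals of the
    approximating scores approximate with an error no larger than before. *)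
Lemma tangent_resid (a : 'cV[R]_p) :
  tangent_space mu M P0 (fun z => (a^T *m varphi z) 0 0) ->
  tangent_space mu Mred P0 (fun z => (a^T *m D z) 0 0).
Proof.
pose h z := \sum_i a i 0 * varphi z i 0; pose hX x := \sum_i a i 0 * phi x i 0.
have hE : (fun z => (a^T *m varphi z) 0 0) = h by apply/funext => z; rewrite row_mulE.
have rE : (fun z => (a^T *m D z) 0 0) = (fun z => h z - hX z.1).
  apply/funext => z; rewrite row_mulE /h /hX -sumrB; apply: eq_bigr => i _.
  by rewrite !mxE mulrBr.
have sh : sqint P0 h by exact: sqint_sum.
have ph : l2_proj P0 h hX by exact: l2_proj_sum.
have [mhX shX _] := ph.
rewrite hE rE => -[_ appr]; split.
  by apply/L20P; split; [exact: sqintB|exact: (mean_proj_resid sh ph)].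
move=> e e0; have [n [c [s [scs]]]] := appr e e0.
have ss i : sqint P0 (s i).
  by have [T [t0 [Pt [_ _ _ /L20P[]]]]] := scs i.
have /choice[sX psX] i : exists g, l2_proj P0 (s i) g by exact: l2_proj_ex.
have sc : sqint P0 (fun z => \sum_i c i * s i z) by exact: sqint_sum.
have pc : l2_proj P0 (fun z => \sum_i c i * s i z) (fun x => \sum_i c i * sX i x).
  exact: l2_proj_sum.
have sf : sqint P0 (fun z => h z - \sum_i c i * s i z) by exact: sqintB.
have pf := l2_projB sh sc ph pc; have [mfX sfX _] := pf.
rewrite Lnorm2_nrm// lte_fin => lt_e.
exists n, c, (fun i z => s i z - sX i z.1); split.
  by move=> i; exact: (conditional_score dom MXPX MYXK (scs i) (psX i)).
have -> : (fun z => h z - hX z.1 - \sum_i c i * (s i z - sX i z.1)) =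
    (fun z => (h z - \sum_i c i * s i z) - (hX z.1 - \sum_i c i * sX i z.1)).
  apply/funext => z; under eq_bigr do rewrite mulrBr.
  by rewrite sumrB; ring.
rewrite Lnorm2_nrm; last exact: (sqintB sf sfX).
rewrite lte_fin; apply: le_lt_trans lt_e; exact: (nrm_proj_resid sf pf).
Qed.

Lemma efficient_influence_function_resid :
  efficient_influence_function mu M P0 theta varphi ->
  efficient_influence_function mu Mred P0 theta D.
Proof.
move=> [grad tan]; split; first exact: gradient_resid.
by move=> a; exact: tangent_resid.
Qed.

End reduced_influence_function.

Unset Implicit Arguments.
Set Strict Implicit.
Set Printing Implicit Defensive.

Theorem theorem3p1 (R : realType) (dX dY : measure_display)
    (X : measurableType dX) (Y : measurableType dY) (p : nat)
    (mu : {sigma_finite_measure set (X * Y)%type -> \bar R})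
    (MX : set (probability X R)) (MYX : set (R.-pker X ~> Y))
    (PX : probability X R) (K : R.-pker X ~> Y)
    (Theta : set 'cV[R]_p)
    (theta : probability (X * Y)%type R -> 'cV[R]_p)
    (Omega : metricType R)
    (eta : probability (X * Y)%type R -> Omega)
    (varphi : Omega -> X * Y -> 'cV[R]_p)
    (phi : X -> 'cV[R]_p) :
  let M := product_model MX MYX in
  let Mred := product_model [set PX] MYX in
  let P0 : probability (X * Y)%type R := joint PX K in
  let varphi0 := varphi (eta P0) in
  let D := fun z : X * Y => varphi0 z - phi z.1 in
  (forall P, M P -> P `<< mu) ->
  MX PX -> MYX K ->
  (forall P, M P -> Theta (theta P)) ->
  efficient_influence_function mu M P0 theta varphi0 ->
  (forall i, cond_expectation P0 (fun z : X * Y => varphi0 z i 0)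
                                 (fun x => phi x i 0)) ->
  [/\ efficient_influence_function mu Mred P0 theta D,
      efficiency_bound mu Mred P0 theta (covmx P0 D),
      covmx P0 D = covmx P0 varphi0 - covmx P0 (fun z => phi z.1) &
      loewner_le (covmx P0 D) (covmx P0 varphi0)].
Proof.
move=> M Mred P0 varphi0 D dom MXPX MYXK _ eif ce.
have [[vv _] _] := eif.
have pr i : l2_proj P0 (fun z => varphi0 z i 0) (fun x => phi x i 0).
  by apply: cond_expectation_proj; [have [] := (vL20P _ _).1 vv i|exact: ce].
have eifD : efficient_influence_function mu Mred P0 theta D.
  exact: (efficient_influence_function_resid dom MXPX MYXK vv pr eif).
have covD := covmx_resid vv pr.
split => //; first by exists D.
(* The difference of the two bounds is the covariance matrix of phi. *)
rewrite /loewner_le covD opprB addrC subrK.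
exact: psd_covmx (vL20_proj vv pr).
Qed.
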